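(* Let $A>0$, $K\ne0$, $D\ge2$, and $a_1,b_0$ be numbers, and let $\mathcal{C}=[[0,a_1,A(n-1)],[b_0,-K(Dn-1)(D(n-1)+1)]]$. Assume $A^2-4KD^2>0$ and define $$R=\frac{A+\sqrt{A^2-4KD^2}}{2},\qquad E=\frac{R^2}{KD^2}.$$ Let $p(n)/q(n)$ be the $n$th convergent of $\mathcal{C}$ and $(p'(n),q'(n))=(p(n),q(n))/f(n)$ with $f(n)=|K|^{\lfloor n/2\rfloor}\prod_{1\le j\le n}(D(j-1)+1)$. Then $\mathcal{C}$ converges exponentially fast to some limit $L$, and more precisely: (1) there are nonzero constants $C_1,C_2$ with $L-p(n)/q(n)\sim C_1/E^n$, $q(n)\sim C_2(n-1)!R^n$, and $\log(|q'(n)L-p'(n)|)\sim -n\log(|E|)/2$ as $n\to\infty$; (2) $L=\dfrac{b_0}{a_1-|K|^{1/2}Q}$, where $Q=\dfrac{T_1(1/2,1-1/D;z_0)}{T_0(1/2,1-1/D;z_0)}$ with $z_0=\dfrac12+\dfrac{A}{4D|K|^{1/2}}$.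
   Context: Continued fraction notation: $[[a_0,a_1,a(n)],[b_0,b(n)]]$ denotes $a_0+b_0/(a_1+b(1)/(a(2)+b(2)/(a(3)+\cdots)))$, with convergents $p(n)/q(n)$ given by $p(0)=a_0$, $q(0)=1$, $p(1)=a_0a_1+b_0$, $q(1)=a_1$, $p(n+1)=a(n+1)p(n)+b(n)p(n-1)$, $q(n+1)=a(n+1)q(n)+b(n)q(n-1)$ ($n\ge1$). Here $a_0=0$, $a(n)=A(n-1)$ for $n\ge2$, $b(n)=-K(Dn-1)(D(n-1)+1)$ for $n\ge1$. For parameters $a,b,z$, $$T_n(a,b;z)=\frac{\Gamma(a+n)\Gamma(b+n)}{\Gamma(2a+2n)}(1/z)^{a+n}\,{}_2F_1(a+n,b+n;2a+2n;1/z),$$ with ${}_2F_1$ the Gauss hypergeometric function.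
   Formalization: The formal theorem takes all numbers real, adds b_0≠0 (else L-p(n)/q(n)=0) and that |p(n)/q(n)| does not tend to infinity (this fails for one exceptional a_1), and states formula (2) only for K>0, since with |K|^{1/2} it is false or undefined for K<0. *)

(* Defs.v *)
From Stdlib Require Import Reals Factorial.
From Coquelicot Require Import Coquelicot.
Open Scope R_scope.

(** ** Continued fractions

    [a 0 + b 0 / (a 1 + b 1 / (a 2 + b 2 / ...))].  The partial numerator under
    [a n] is [b n], so the recurrence for the convergents uses [b n] (not
    [b (n+1)]) together with [a (n+1)]. *)

Fixpoint cf_num (a b : nat -> R) (n : nat) {struct n} : R :=
  match n with
  | O => a 0%nat
  | S m => match m with
           | O => a 0%nat * a 1%nat + b 0%nat
           | S k => a (S m) * cf_num a b m + b m * cf_num a b k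
           end
  end.

Fixpoint cf_den (a b : nat -> R) (n : nat) {struct n} : R :=
  match n with
  | O => 1
  | S m => match m with
           | O => a 1%nat
           | S k => a (S m) * cf_den a b m + b m * cf_den a b k
           end
  end.

Definition converges_exponentially (u : nat -> R) (L : R) : Prop :=
  is_lim_seq u L /\
  exists M r : R, 0 <= r < 1 /\
    eventually (fun n => Rabs (L - u n) <= M * r ^ n).

(** [u ~ v] as [n] tends to infinity. *)
Definition equiv_seq (u v : nat -> R) : Prop := is_equiv eventually u v.

(** [prod1 u n] is the product of the [u j] over [1 <= j <= n]. *)
Fixpoint prod1 (u : nat -> R) (n : nat) : R :=
  match n with
  | O => 1
  | S m => prod1 u m * u (S m)
  end.

(** ** Special functions *)

(** Euler's integral, meaningful for [0 < x]. *)
Definition Gamma (x : R) : R :=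
  RInt_gen (fun t => Rpower t (x - 1) * exp (- t))
           (at_right 0) (Rbar_locally p_infty).

Definition pochhammer (a : R) (n : nat) : R :=
  prod1 (fun j => a + INR j - 1) n.

(** The Gauss series, meaningful for [Rabs x < 1] and [c] not a nonpositive
    integer. *)
Definition hyp2F1 (a b c x : R) : R :=
  PSeries (fun k => pochhammer a k * pochhammer b k
                    / (pochhammer c k * INR (fact k))) x.

(** Meaningful for [1 < z] and [0 < a], [0 < b]. *)
Definition T (n : nat) (a b z : R) : R :=
  Gamma (a + INR n) * Gamma (b + INR n) / Gamma (2 * a + 2 * INR n)
  * Rpower (1 / z) (a + INR n)
  * hyp2F1 (a + INR n) (b + INR n) (2 * a + 2 * INR n) (1 / z).

(** ** The continued fraction [[0, a1, A(n-1)], [b0, -K(Dn-1)(D(n-1)+1)]] *)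

Definition Ca (A a1 : R) (n : nat) : R :=
  match n with
  | O => 0
  | S O => a1
  | _ => A * (INR n - 1)
  end.

Definition Cb (K D b0 : R) (n : nat) : R :=
  match n with
  | O => b0
  | _ => - K * (D * INR n - 1) * (D * (INR n - 1) + 1)
  end.

Definition Cp (A K D a1 b0 : R) : nat -> R := cf_num (Ca A a1) (Cb K D b0).
Definition Cq (A K D a1 b0 : R) : nat -> R := cf_den (Ca A a1) (Cb K D b0).

Definition Rroot (A K D : R) : R := (A + sqrt (A ^ 2 - 4 * K * D ^ 2)) / 2.
Definition Erate (A K D : R) : R := Rroot A K D ^ 2 / (K * D ^ 2).

Definition fnorm (K D : R) (n : nat) : R :=
  Rabs K ^ (Nat.div n 2) * prod1 (fun j => D * (INR j - 1) + 1) n.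

Definition z0 (A K D : R) : R := 1 / 2 + A / (4 * D * sqrt (Rabs K)).

Definition Q (A K D : R) : R :=
  T 1 (1 / 2) (1 - 1 / D) (z0 A K D) / T 0 (1 / 2) (1 - 1 / D) (z0 A K D).

(* Main.v *)
Require Import Defs.
From Stdlib Require Import Reals Factorial Lra Lia Classical.
From Coquelicot Require Import Coquelicot.
Open Scope R_scope.

(** After division by [(n-1)! R^n] the recurrence of the convergents becomes
    [v(n+2) = (1 + e) v(n+1) - (e + d/((n+1)(n+2))) v(n)] with [e = 1/E],
    [|e| < 1], a summable perturbation of a recurrence with characteristic roots
    [1] and [e].  So every solution converges, solutions not all to [0], and the
    Casoratian is asymptotic to a nonzero multiple of [e^n].  The denominators
    tend to a nonzero limit (otherwise [|p/q|] would tend to infinity), and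
    [L - p/q] is a tail of the series with terms Casoratian over [q(n) q(n+1)].

    For [K > 0], a contiguous relation shows that the normalized [T_n(1/2,1-1/D;z)]
    solve the same recurrence, and by Pincherle's theorem it remains to see that
    this solution is minimal.  This follows from monotonicity: as [x = 1/z]
    increases, the solution increases while the dominant root [R] strictly
    decreases; since the solution at [x' > x] is [O((n-1)! R(x')^n)], the one at
    [x] is [o((n-1)! R(x)^n)]. *)

(** * Recurrences with a summable perturbation *)

(** The perturbation is summable because of the exact identity [(D (n+2) - 1) (D (n+1) + 1) = D^2
    (n+1) (n+2) + (D - 1)]: no linear term is left over, so [(n-1)! R^n] needs no further power of
    [n]. The remaining term telescopes after division, so every error is at most an explicit
    constant over [n + 1]. Such bounds, rather than mere convergence, are what shows that limits
    differ from [0].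

    The obstacle to the closed form is that a hypergeometric series does not display its growth in
    [n]. The comparison of two arguments replaces asymptotics of the series, and it needs a family
    of recurrences with [K] and [D] fixed. With [s = D sqrt K] and [x = 1/z0] one has
    [K = s^2 / D^2], [A = s (4/x - 2)] and [A^2 - 4 K D^2 = 16 s^2 (1/x) (1/x - 1)]: for [A > 0] the
    discriminant condition amounts to [0 < x < 1], and [x] moves [A] alone. A real [s] gives
    [K > 0], which ties the closed form to that sign. *)

(* [/ ((n + 1) * (n + 2))], written so that its sum telescopes. *)
Definition gap (n : nat) : R := / (INR n + 1) - / (INR n + 2).

Lemma gap_eq (n : nat) : gap n = / ((INR n + 1) * (INR n + 2)).
Proof. unfold gap; pose proof (pos_INR n); field; lra. Qed.

Lemma gap_pos (n : nat) : 0 < gap n.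
Proof.
  rewrite gap_eq; pose proof (pos_INR n).
  apply Rinv_0_lt_compat, Rmult_lt_0_compat; lra.
Qed.

Lemma exp_le_compat (x y : R) : x <= y -> exp x <= exp y.
Proof.
  intros [h|h]; [apply Rlt_le, exp_increasing, h|subst y; apply Rle_refl].
Qed.

(* [s n * exp (C / (n + 1))] is nonincreasing, because [1 + x <= exp x] and
   [gap] telescopes. *)
Lemma growth_bound (s : nat -> R) (C : R) :
  0 <= C -> (forall n, 0 <= s n) ->
  (forall n, s (S n) <= s n * (1 + C * gap n)) ->
  forall n k, s (n + k)%nat <= s n * exp C.
Proof.
  intros hC hs hrec n k.
  assert (H : s (n + k)%nat * exp (C * / (INR (n + k) + 1))
              <= s n * exp (C * / (INR n + 1))).
  { induction k as [|k IH].
    - rewrite Nat.add_0_r; apply Rle_refl.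
    - apply Rle_trans with (2 := IH).
      rewrite Nat.add_succ_r, S_INR.
      apply Rle_trans with
        (s (n + k)%nat * exp (C * gap (n + k)) * exp (C * / (INR (n + k) + 1 + 1))).
      + apply Rmult_le_compat_r; [apply Rlt_le, exp_pos|].
        apply Rle_trans with (1 := hrec _).
        apply Rmult_le_compat_l; [apply hs|apply exp_ineq1_le].
      + rewrite Rmult_assoc, <- exp_plus.
        apply Req_le; f_equal; f_equal; unfold gap.
        replace (INR (n + k) + 1 + 1) with (INR (n + k) + 2) by ring; ring. }
  assert (h0 : forall j, 0 <= / (INR j + 1) <= 1).
  { intros j; pose proof (pos_INR j); split.
    - apply Rlt_le, Rinv_0_lt_compat; lra.
    - rewrite <- Rinv_1; apply Rinv_le_contravar; lra. }
  apply Rle_trans with (s (n + k)%nat * exp (C * / (INR (n + k) + 1))).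
  - rewrite <- (Rmult_1_r (s (n + k)%nat)) at 1.
    apply Rmult_le_compat_l; [apply hs|].
    apply Rle_trans with (exp 0); [rewrite exp_0; apply Rle_refl|apply exp_le_compat].
    apply Rmult_le_pos; [exact hC|apply h0].
  - apply Rle_trans with (1 := H).
    apply Rmult_le_compat_l; [apply hs|].
    apply exp_le_compat.
    rewrite <- (Rmult_1_r C) at 2.
    apply Rmult_le_compat_l; [exact hC|apply h0].
Qed.

Lemma gap_sum_bound (m : nat -> R) (B : R) (n k : nat) :
  (forall j, (n <= j)%nat -> Rabs (m (S j) - m j) <= B * gap j) ->
  0 <= B ->
  Rabs (m (n + k)%nat - m n) <= B / (INR n + 1).
Proof.
  intros h hB.
  assert (H : Rabs (m (n + k)%nat - m n)
              <= B * (/ (INR n + 1) - / (INR (n + k) + 1))).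
  { induction k as [|k IH].
    - rewrite Nat.add_0_r, !Rminus_diag, Rabs_R0; lra.
    - rewrite Nat.add_succ_r, S_INR.
      replace (m (S (n + k)) - m n)
        with ((m (S (n + k)) - m (n + k)%nat) + (m (n + k)%nat - m n)) by ring.
      apply Rle_trans with (1 := Rabs_triang _ _).
      specialize (h (n + k)%nat ltac:(lia)); unfold gap in h.
      replace (INR (n + k) + 1 + 1) with (INR (n + k) + 2) by ring; lra. }
  apply Rle_trans with (1 := H).
  unfold Rdiv; apply Rmult_le_compat_l; [exact hB|].
  pose proof (pos_INR (n + k)).
  assert (0 < / (INR (n + k) + 1)) by (apply Rinv_0_lt_compat; lra); lra.
Qed.

Lemma is_lim_seq_const_div_succ (B : R) :
  is_lim_seq (fun n => B / (INR n + 1)) 0.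
Proof.
  replace (Finite 0) with (Rbar_mult B 0) by (simpl; f_equal; ring).
  apply is_lim_seq_scal_l.
  replace (Finite 0) with (Rbar_inv p_infty) by reflexivity.
  apply is_lim_seq_inv; [|discriminate].
  apply is_lim_seq_ext with (fun n => INR (S n)).
  - intros n; apply S_INR.
  - apply (is_lim_seq_incr_1 INR), is_lim_seq_INR.
Qed.

Lemma is_lim_seq_eventually (u : nat -> R) (l eps : R) :
  is_lim_seq u l -> 0 < eps -> eventually (fun n => Rabs (u n - l) < eps).
Proof.
  intros h he; apply is_lim_seq_spec in h; exact (h (mkposreal eps he)).
Qed.

Lemma gap_cv (m : nat -> R) (B : R) :
  0 <= B -> (forall j, Rabs (m (S j) - m j) <= B * gap j) ->
  exists l : R, is_lim_seq m l.
Proof.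
  intros hB h.
  apply ex_lim_seq_cauchy_corr.
  intros eps.
  destruct (is_lim_seq_eventually _ _ (eps / 2)
              (is_lim_seq_const_div_succ B)) as [N HN];
    [pose proof (cond_pos eps); lra|].
  specialize (HN N (le_n _)).
  rewrite Rminus_0_r in HN.
  pose proof (Rle_abs (B / (INR N + 1))) as HA.
  exists N; intros i j hi hj.
  replace (m i - m j) with ((m i - m N) - (m j - m N)) by ring.
  apply Rle_lt_trans with (1 := Rabs_triang _ _).
  rewrite Rabs_Ropp.
  pose proof (gap_sum_bound m B N (i - N) (fun j _ => h j) hB).
  pose proof (gap_sum_bound m B N (j - N) (fun j _ => h j) hB).
  replace (N + (i - N))%nat with i in * by lia.
  replace (N + (j - N))%nat with j in * by lia.
  lra.
Qed.

Lemma gap_cv_dist (m : nat -> R) (B l : R) (n : nat) :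
  0 <= B -> is_lim_seq m l ->
  (forall j, (n <= j)%nat -> Rabs (m (S j) - m j) <= B * gap j) ->
  Rabs (l - m n) <= B / (INR n + 1).
Proof.
  intros hB hl h.
  apply (is_lim_seq_le (fun k => Rabs (m (k + n)%nat - m n))
           (fun _ => B / (INR n + 1)) (Rabs (l - m n)) (B / (INR n + 1))).
  - intros k; rewrite Nat.add_comm; apply gap_sum_bound; assumption.
  - apply (is_lim_seq_abs _ (Finite (l - m n))).
    apply is_lim_seq_minus'; [|apply is_lim_seq_const].
    apply (is_lim_seq_incr_n m n), hl.
  - apply is_lim_seq_const.
Qed.

(** By [growth_bound] the terms after [N] are bounded by a multiple of [g N] itself. A limit [0]
    would therefore force [|g N| <= C |g N| / (N + 1)] with [C] independent of [N], which fails for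
    large [N]. *)
Lemma gap_product_cv (g : nat -> R) (c : R) :
  (forall n, g n <> 0) ->
  (forall n, g (S n) = (1 + c * gap n) * g n) ->
  exists l : R, l <> 0 /\ is_lim_seq g l.
Proof.
  intros hg hrec.
  assert (hC := Rabs_pos c).
  assert (hb : forall n k, Rabs (g (n + k)%nat) <= Rabs (g n) * exp (Rabs c)).
  { apply (growth_bound (fun n => Rabs (g n))); [exact hC|intros; apply Rabs_pos|].
    intros n; rewrite hrec, Rabs_mult, Rmult_comm.
    apply Rmult_le_compat_l; [apply Rabs_pos|].
    apply Rle_trans with (1 := Rabs_triang _ _).
    rewrite Rabs_R1, Rabs_mult, (Rabs_pos_eq (gap n)); [lra|].
    apply Rlt_le, gap_pos. }
  set (B := fun n => Rabs c * exp (Rabs c) * Rabs (g n)).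
  assert (hB : forall n, 0 <= B n).
  { intros n; unfold B; apply Rmult_le_pos; [|apply Rabs_pos].
    apply Rmult_le_pos; [exact hC|apply Rlt_le, exp_pos]. }
  assert (hd : forall n j, (n <= j)%nat ->
            Rabs (g (S j) - g j) <= B n * gap j).
  { intros n j hj.
    rewrite hrec.
    replace ((1 + c * gap j) * g j - g j) with (c * gap j * g j) by ring.
    rewrite !Rabs_mult, (Rabs_pos_eq (gap j)) by apply Rlt_le, gap_pos.
    specialize (hb n (j - n)%nat).
    replace (n + (j - n))%nat with j in hb by lia.
    unfold B.
    apply (Rmult_le_compat_l (Rabs c * gap j)) in hb.
    - lra.
    - apply Rmult_le_pos; [exact hC|apply Rlt_le, gap_pos]. }
  destruct (gap_cv g (B 0%nat) (hB _) (fun j => hd 0%nat j (Nat.le_0_l j)))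
    as [l hl].
  exists l; split; [|exact hl].
  intros h0; subst l.
  destruct (is_lim_seq_eventually _ _ 1
    (is_lim_seq_const_div_succ (Rabs c * exp (Rabs c)))) as [N HN]; [lra|].
  specialize (HN N (le_n _)); rewrite Rminus_0_r in HN.
  apply Rle_lt_trans with (1 := Rle_abs _) in HN.
  pose proof (gap_cv_dist g (B N) 0 N (hB _) hl (hd N)) as hN.
  rewrite Rminus_0_l, Rabs_Ropp in hN.
  pose proof (Rabs_pos_lt _ (hg N)) as hp.
  replace (B N / (INR N + 1))
    with (Rabs c * exp (Rabs c) / (INR N + 1) * Rabs (g N)) in hN
    by (unfold B, Rdiv; ring).
  apply (Rmult_lt_compat_r (Rabs (g N))) in HN; lra.
Qed.

Lemma contraction_cv0 (e : R) (s t : nat -> R) :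
  Rabs e < 1 -> (forall n, s (S n) = e * s n + t n) ->
  is_lim_seq t 0 -> is_lim_seq s 0.
Proof.
  intros he hrec ht.
  apply is_lim_seq_spec; intros eps; pose proof (cond_pos eps) as hp.
  (* This threshold for [t] makes the level [eps / 2] invariant:
     [|e| eps/2 + (1 - |e|) eps/2 = eps/2]. *)
  assert (he' : 0 < eps / 2 * (1 - Rabs e)) by (apply Rmult_lt_0_compat; lra).
  destruct (is_lim_seq_eventually _ _ _ ht he') as [N HN].
  assert (H : forall k, Rabs (s (k + N)%nat) <= Rabs e ^ k * Rabs (s N) + eps / 2).
  { induction k as [|k IH]; simpl.
    - lra.
    - rewrite hrec.
      apply Rle_trans with (1 := Rabs_triang _ _); rewrite Rabs_mult.
      specialize (HN (k + N)%nat ltac:(lia)); rewrite Rminus_0_r in HN.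
      apply (Rmult_le_compat_l (Rabs e)) in IH; [lra|apply Rabs_pos]. }
  assert (hg : is_lim_seq (fun k => Rabs (s N) * Rabs e ^ k) 0).
  { replace (Finite 0) with (Rbar_mult (Rabs (s N)) 0) by (simpl; f_equal; ring).
    apply is_lim_seq_scal_l, is_lim_seq_geom; rewrite Rabs_Rabsolu; exact he. }
  destruct (is_lim_seq_eventually _ _ (eps / 2) hg) as [M HM]; [lra|].
  exists (N + M)%nat; intros n hn; rewrite Rminus_0_r.
  specialize (HM (n - N)%nat ltac:(lia)); specialize (H (n - N)%nat).
  replace (n - N + N)%nat with n in H by lia.
  rewrite Rminus_0_r in HM; apply Rle_lt_trans with (1 := Rle_abs _) in HM.
  lra.
Qed.

(** If the increments were exactly [c e^n], the tail from [n] on would be [c e^n / (1 - e)]. Adding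
    this to [x n] gives [z], whose increments are [o(e^n)]; so are its tails, by summing a geometric
    series in [|e|]. *)
Lemma geometric_tail (e c : R) (x : nat -> R) :
  Rabs e < 1 -> e <> 0 ->
  is_lim_seq (fun n => (x (S n) - x n) / e ^ n) c ->
  exists L : R, is_lim_seq (fun n => (L - x n) / e ^ n) (c / (1 - e)).
Proof.
  intros he he0 hx.
  assert (he1 : 1 - e <> 0) by (pose proof (Rle_abs e); lra).
  set (z := fun n => x n + c * e ^ n / (1 - e)).
  assert (hstep : forall n, z (S n) - z n = e ^ n * ((x (S n) - x n) / e ^ n - c)).
  { intros n; unfold z; simpl; field; split; [apply pow_nonzero|]; assumption. }
  assert (hz : forall eps, 0 < eps -> exists N, forall n k, (N <= n)%nat ->
             Rabs (z (k + n)%nat - z n) <= eps * Rabs e ^ n).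
  { intros eps hp.
    destruct (is_lim_seq_eventually _ _ (eps * (1 - Rabs e)) hx) as [N HN];
      [apply Rmult_lt_0_compat; lra|].
    exists N; intros n k hn.
    assert (H : Rabs (z (k + n)%nat - z n)
                <= eps * Rabs e ^ n - eps * Rabs e ^ (k + n)).
    { induction k as [|k IH]; simpl.
      - rewrite Rminus_diag, Rabs_R0; lra.
      - replace (z (S (k + n)) - z n)
          with ((z (S (k + n)) - z (k + n)%nat) + (z (k + n)%nat - z n)) by ring.
        apply Rle_trans with (1 := Rabs_triang _ _).
        rewrite hstep, Rabs_mult, <- RPow_abs.
        specialize (HN (k + n)%nat ltac:(lia)).
        apply Rlt_le, (Rmult_le_compat_l (Rabs e ^ (k + n))) in HN;
          [lra|apply pow_le, Rabs_pos]. }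
    apply Rle_trans with (1 := H).
    assert (0 <= eps * Rabs e ^ (k + n)).
    { apply Rmult_le_pos; [lra|apply pow_le, Rabs_pos]. }
    lra. }
  assert (hc : exists L : R, is_lim_seq z L).
  { apply ex_lim_seq_cauchy_corr; intros eps; pose proof (cond_pos eps) as hp.
    destruct (hz (eps / 4)) as [N HN]; [lra|].
    assert (hle : eps / 4 * Rabs e ^ N <= eps / 4).
    { rewrite <- (Rmult_1_r (eps / 4)) at 2.
      apply Rmult_le_compat_l; [lra|].
      rewrite <- (pow1 N); apply pow_incr; split; [apply Rabs_pos|lra]. }
    exists N; intros i j hi hj.
    replace (z i - z j) with ((z i - z N) - (z j - z N)) by ring.
    apply Rle_lt_trans with (1 := Rabs_triang _ _); rewrite Rabs_Ropp.
    pose proof (HN N (i - N)%nat (le_n _)) as h1.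
    pose proof (HN N (j - N)%nat (le_n _)) as h2.
    replace (i - N + N)%nat with i in h1 by lia.
    replace (j - N + N)%nat with j in h2 by lia.
    lra. }
  destruct hc as [L hL]; exists L.
  apply is_lim_seq_spec; intros eps; pose proof (cond_pos eps) as hp.
  destruct (hz (eps / 2)) as [N HN]; [lra|].
  exists N; intros n hn.
  assert (H : Rabs (L - z n) <= eps / 2 * Rabs e ^ n).
  { apply (is_lim_seq_le (fun k => Rabs (z (k + n)%nat - z n))
             (fun _ => eps / 2 * Rabs e ^ n)
             (Rabs (L - z n)) (eps / 2 * Rabs e ^ n)).
    - intros k; apply HN, hn.
    - apply (is_lim_seq_abs _ (Finite (L - z n))).
      apply is_lim_seq_minus'; [|apply is_lim_seq_const].
      apply (is_lim_seq_incr_n z n), hL.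
    - apply is_lim_seq_const. }
  assert (hen : 0 < Rabs e ^ n) by apply pow_lt, Rabs_pos_lt, he0.
  replace ((L - x n) / e ^ n - c / (1 - e)) with ((L - z n) / e ^ n)
    by (unfold z; field; split; [|apply pow_nonzero]; assumption).
  rewrite Rabs_div by (apply pow_nonzero, he0); rewrite <- RPow_abs.
  apply Rle_lt_trans with (eps / 2); [|lra].
  apply Rle_div_l; [exact hen|exact H].
Qed.

Definition perturbed_rec (e d : R) (v : nat -> R) : Prop :=
  forall n, v (S (S n)) = (1 + e) * v (S n) - (e + d * gap n) * v n.

(* [v (S n) - e * v n] and [v (S n) - v n] are the components of [v] along the
   characteristic roots [1] and [e] of the unperturbed recurrence. *)
Lemma perturbed_rec_cv (e d : R) (v : nat -> R) :
  Rabs e < 1 -> perturbed_rec e d v ->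
  exists l : R, is_lim_seq v l /\
    forall n, Rabs ((1 - e) * l - (v (S n) - e * v n))
      <= Rabs d / (1 - e) * exp (2 * (Rabs d / (1 - e)))
         * (Rabs (v (S n) - e * v n) + Rabs (v (S n) - v n)) / (INR n + 1).
Proof.
  intros he hrec.
  assert (he1 : 0 < 1 - e) by (pose proof (Rle_abs e); lra).
  set (m := fun n => v (S n) - e * v n).
  set (s := fun n => Rabs (m n) + Rabs (v (S n) - v n)).
  set (c := Rabs d / (1 - e)).
  assert (hc : 0 <= c) by (apply Rdiv_le_0_compat; [apply Rabs_pos|exact he1]).
  assert (hs0 : forall n, 0 <= s n).
  { intros n; unfold s; pose proof (Rabs_pos (m n));
      pose proof (Rabs_pos (v (S n) - v n)); lra. }
  assert (hv : forall n, Rabs (d * gap n * v n) <= c * gap n * s n).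
  { intros n; rewrite !Rabs_mult, (Rabs_pos_eq (gap n)) by apply Rlt_le, gap_pos.
    replace (v n) with ((m n - (v (S n) - v n)) / (1 - e)) by (unfold m; field; lra).
    rewrite Rabs_div by lra; rewrite (Rabs_pos_eq (1 - e)) by lra.
    replace (Rabs d * gap n * (Rabs (m n - (v (S n) - v n)) / (1 - e)))
      with (c * gap n * Rabs (m n - (v (S n) - v n))) by (unfold c; field; lra).
    apply Rmult_le_compat_l.
    - apply Rmult_le_pos; [exact hc|apply Rlt_le, gap_pos].
    - unfold s; rewrite <- (Rabs_Ropp (v (S n) - v n)); apply Rabs_triang. }
  assert (hm : forall n, m (S n) - m n = - (d * gap n * v n)).
  { intros n; unfold m; rewrite hrec; ring. }
  (* The perturbation [d * gap n * v n] enters both components, each time with size at most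
     [c * gap n * s n]; hence the factor [2]. *)
  assert (hs : forall n, s (S n) <= s n * (1 + 2 * c * gap n)).
  { intros n; specialize (hv n).
    assert (h1 : Rabs (m (S n)) <= Rabs (m n) + Rabs (d * gap n * v n)).
    { replace (m (S n)) with (m n + - (d * gap n * v n)) by (rewrite <- hm; ring).
      rewrite <- (Rabs_Ropp (d * gap n * v n)); apply Rabs_triang. }
    assert (h2 : Rabs (v (S (S n)) - v (S n))
                 <= Rabs (v (S n) - v n) + Rabs (d * gap n * v n)).
    { replace (v (S (S n)) - v (S n))
        with (e * (v (S n) - v n) + - (d * gap n * v n)) by (rewrite hrec; ring).
      apply Rle_trans with (1 := Rabs_triang _ _).
      rewrite Rabs_Ropp, Rabs_mult.
      apply Rplus_le_compat_r.
      rewrite <- (Rmult_1_l (Rabs (v (S n) - v n))) at 2.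
      apply Rmult_le_compat_r; [apply Rabs_pos|lra]. }
    unfold s at 1.
    replace (s n * (1 + 2 * c * gap n))
      with (Rabs (m n) + Rabs (v (S n) - v n) + 2 * (c * gap n * s n))
      by (unfold s; ring).
    lra. }
  set (B := fun n => c * exp (2 * c) * s n).
  assert (hB : forall n, 0 <= B n).
  { intros n; unfold B; apply Rmult_le_pos; [|apply hs0].
    apply Rmult_le_pos; [exact hc|apply Rlt_le, exp_pos]. }
  assert (hmB : forall n j, (n <= j)%nat -> Rabs (m (S j) - m j) <= B n * gap j).
  { intros n j hj; rewrite hm, Rabs_Ropp.
    apply Rle_trans with (1 := hv j).
    pose proof (growth_bound s (2 * c) ltac:(lra) hs0 hs n (j - n)) as h.
    replace (n + (j - n))%nat with j in h by lia.
    apply (Rmult_le_compat_l (c * gap j)) in h.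
    - unfold B; lra.
    - apply Rmult_le_pos; [exact hc|apply Rlt_le, gap_pos]. }
  destruct (gap_cv m (B 0%nat) (hB _) (fun j => hmB 0%nat j (Nat.le_0_l j)))
    as [l hl].
  exists (l / (1 - e)); split.
  (* Since [v (S n) = e * v n + m n] with [m] tending to [l], the distance of [v] to the fixed point
     [l / (1 - e)] is contracted, up to an error tending to [0]. *)
  - assert (h0 : is_lim_seq (fun n => v n - l / (1 - e)) 0).
    { apply contraction_cv0 with e (fun n => m n - l); [exact he| |].
      - intros n; unfold m; field; lra.
      - rewrite <- (Rminus_diag l); apply is_lim_seq_minus';
          [exact hl|apply is_lim_seq_const]. }
    apply is_lim_seq_ext with (fun n => (v n - l / (1 - e)) + l / (1 - e)).
    + intros n; ring.
    + replace (Finite (l / (1 - e))) with (Finite (0 + l / (1 - e)))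
        by (f_equal; ring).
      apply is_lim_seq_plus'; [exact h0|apply is_lim_seq_const].
  - intros n.
    replace ((1 - e) * (l / (1 - e))) with l by (field; lra).
    exact (gap_cv_dist m (B n) l n (hB n) hl (hmB n)).
Qed.

(** * Casoratians and ratios of two solutions *)

Definition casoratian (u v : nat -> R) (n : nat) : R :=
  u (S n) * v n - u n * v (S n).

Lemma casoratian_succ (e d : R) (u v : nat -> R) (n : nat) :
  perturbed_rec e d u -> perturbed_rec e d v ->
  casoratian u v (S n) = (e + d * gap n) * casoratian u v n.
Proof. intros hu hv; unfold casoratian; rewrite hu, hv; ring. Qed.

Lemma casoratian_neq0 (e d : R) (u v : nat -> R) :
  perturbed_rec e d u -> perturbed_rec e d v ->
  (forall n, e + d * gap n <> 0) -> casoratian u v 0 <> 0 ->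
  forall n, casoratian u v n <> 0.
Proof.
  intros hu hv hn h0 n; induction n as [|n IH]; [exact h0|].
  rewrite (casoratian_succ e d) by assumption.
  apply Rmult_integral_contrapositive_currified; auto.
Qed.

(** Division by [e ^ n] turns the one-step factor [e + d * gap n] into [1 + d / e * gap n], the
    situation of [gap_product_cv]. *)
Lemma casoratian_cv (e d : R) (u v : nat -> R) :
  e <> 0 -> perturbed_rec e d u -> perturbed_rec e d v ->
  (forall n, e + d * gap n <> 0) -> casoratian u v 0 <> 0 ->
  exists w : R, w <> 0 /\ is_lim_seq (fun n => casoratian u v n / e ^ n) w.
Proof.
  intros he hu hv hn h0.
  apply gap_product_cv with (d / e).
  - intros n; apply Rmult_integral_contrapositive_currified.
    + apply (casoratian_neq0 e d); assumption.
    + apply Rinv_neq_0_compat, pow_nonzero, he.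
  - intros n; rewrite (casoratian_succ e d) by assumption; simpl.
    field; split; [apply pow_nonzero|]; exact he.
Qed.

(* The combination of [u] and [v] with [w N = w (S N) = 1] starts on the
   dominant direction, so for large [N] its limit is close to [1]. *)
Lemma dominant_solution (e d : R) (u v : nat -> R) :
  Rabs e < 1 -> perturbed_rec e d u -> perturbed_rec e d v ->
  (forall n, casoratian u v n <> 0) ->
  is_lim_seq v 0 -> ~ is_lim_seq u 0.
Proof.
  intros he hu hv hW v0 u0.
  assert (he1 : 0 < 1 - e) by (pose proof (Rle_abs e); lra).
  set (c := Rabs d / (1 - e) * exp (2 * (Rabs d / (1 - e)))).
  destruct (is_lim_seq_eventually _ _ 1 (is_lim_seq_const_div_succ c))
    as [N HN]; [lra|].
  specialize (HN N (le_n _)); rewrite Rminus_0_r in HN.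
  apply Rle_lt_trans with (1 := Rle_abs _) in HN.
  set (al := (v N - v (S N)) / casoratian u v N).
  set (be := (u (S N) - u N) / casoratian u v N).
  set (w := fun n => al * u n + be * v n).
  assert (hw : perturbed_rec e d w).
  { intros n; unfold w; rewrite hu, hv; ring. }
  specialize (hW N).
  assert (w1 : w N = 1).
  { unfold w, al, be; unfold casoratian in *; field; exact hW. }
  assert (w2 : w (S N) = 1).
  { unfold w, al, be; unfold casoratian in *; field; exact hW. }
  destruct (perturbed_rec_cv e d w he hw) as [l [hl hb]].
  assert (l0 : l = 0).
  { assert (h : is_lim_seq w 0).
    { replace (Finite 0) with (Finite (al * 0 + be * 0)) by (f_equal; ring).
      apply is_lim_seq_plus'.
      - apply (is_lim_seq_scal_l u al 0 u0).
      - apply (is_lim_seq_scal_l v be 0 v0). }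
    apply is_lim_seq_unique in h; apply is_lim_seq_unique in hl.
    rewrite h in hl; injection hl; auto. }
  (* With limit [0], the error bound at [N] reads [1 - e <= c / (N + 1) * (1 - e)], against the
     choice of [N]. *)
  specialize (hb N); rewrite w1, w2, l0 in hb.
  replace ((1 - e) * 0 - (1 - e * 1)) with (- (1 - e)) in hb by ring.
  rewrite Rabs_Ropp, Rminus_diag, Rabs_R0 in hb.
  replace (1 - e * 1) with (1 - e) in hb by ring.
  rewrite Rabs_pos_eq in hb by lra.
  fold c in hb.
  replace (c * (1 - e + 0) / (INR N + 1)) with (c / (INR N + 1) * (1 - e)) in hb
    by (unfold Rdiv; ring).
  apply (Rmult_lt_compat_r (1 - e)) in HN; lra.
Qed.

Lemma is_lim_seq_neq0_eventually (v : nat -> R) (l : R) :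
  is_lim_seq v l -> l <> 0 -> eventually (fun n => v n <> 0).
Proof.
  intros hv hl.
  destruct (is_lim_seq_eventually v l (Rabs l) hv (Rabs_pos_lt l hl)) as [N HN].
  exists N; intros n hn h0; specialize (HN n hn).
  rewrite h0, Rminus_0_l, Rabs_Ropp in HN; lra.
Qed.

(** The nonzero [c], which makes the rate exact, is inherited from the nonzero limit [w] of the
    normalized Casoratian: it is [w / (V^2 (1 - e))]. *)
Lemma solution_ratio_cv (e d : R) (u v : nat -> R) (V : R) :
  Rabs e < 1 -> e <> 0 -> perturbed_rec e d u -> perturbed_rec e d v ->
  (forall n, e + d * gap n <> 0) -> casoratian u v 0 <> 0 ->
  is_lim_seq v V -> V <> 0 ->
  exists L c : R, c <> 0 /\ is_lim_seq (fun n => (L - u n / v n) / e ^ n) c.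
Proof.
  intros he he0 hu hv hn h0 hV V0.
  assert (he1 : 1 - e <> 0) by (pose proof (Rle_abs e); lra).
  destruct (casoratian_cv e d u v) as [w [w0 hw]]; try assumption.
  destruct (geometric_tail e (w / (V * V)) (fun n => u n / v n) he he0)
    as [L hL].
  - apply is_lim_seq_ext_loc
      with (fun n => casoratian u v n / e ^ n / (v n * v (S n))).
    + destruct (is_lim_seq_neq0_eventually v V hV V0) as [N HN].
      exists N; intros n hnN.
      pose proof (HN n hnN); pose proof (HN (S n) ltac:(lia)).
      unfold casoratian; field; repeat split; auto using pow_nonzero.
    + apply is_lim_seq_div'; [exact hw| |].
      * apply is_lim_seq_mult'; [exact hV|].
        apply (is_lim_seq_incr_1 v), hV.
      * apply Rmult_integral_contrapositive_currified; exact V0.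
  - exists L, (w / (V * V) / (1 - e)); split; [|exact hL].
    repeat apply Rmult_integral_contrapositive_currified;
      try apply Rinv_neq_0_compat; auto.
Qed.

(** * Convergents *)

Definition cf_rec (A K D : R) (y : nat -> R) : Prop :=
  forall n, y (S (S n))
    = A * (INR n + 1) * y (S n)
      - K * (D * (INR n + 1) - 1) * (D * INR n + 1) * y n.

Lemma Cp_rec (A K D a1 b0 : R) : cf_rec A K D (Cp A K D a1 b0).
Proof.
  intros n.
  change (Cp A K D a1 b0 (S (S n)))
    with (A * (INR (S (S n)) - 1) * Cp A K D a1 b0 (S n)
          + - K * (D * INR (S n) - 1) * (D * (INR (S n) - 1) + 1)
            * Cp A K D a1 b0 n).
  rewrite !S_INR; ring.
Qed.

Lemma Cq_rec (A K D a1 b0 : R) : cf_rec A K D (Cq A K D a1 b0).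
Proof.
  intros n.
  change (Cq A K D a1 b0 (S (S n)))
    with (A * (INR (S (S n)) - 1) * Cq A K D a1 b0 (S n)
          + - K * (D * INR (S n) - 1) * (D * (INR (S n) - 1) + 1)
            * Cq A K D a1 b0 n).
  rewrite !S_INR; ring.
Qed.

Definition normalized (r : R) (y : nat -> R) (n : nat) : R :=
  y (S n) / (INR (fact n) * r ^ S n).

(* Also valid when [v (S n) = 0], both sides being the junk value [0]. *)
Lemma normalized_ratio (r : R) (u v : nat -> R) (n : nat) :
  r <> 0 -> normalized r u n / normalized r v n = u (S n) / v (S n).
Proof.
  intros hr; unfold normalized.
  assert (h : INR (fact n) * r ^ S n <> 0).
  { apply Rmult_integral_contrapositive_currified;
      [apply INR_fact_neq_0|apply pow_nonzero, hr]. }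
  set (c := INR (fact n) * r ^ S n) in *.
  unfold Rdiv; rewrite Rinv_mult, Rinv_inv.
  rewrite (Rmult_comm (/ v (S n))), Rmult_assoc, <- (Rmult_assoc (/ c)).
  rewrite Rinv_l, Rmult_1_l by exact h; reflexivity.
Qed.

(** The root equation gives [A / r = 1 + e]; the two terms of [D^2 (n+1) (n+2) + (D - 1)] give [e]
    and [d * gap n]. *)
Lemma normalized_rec (A K D r : R) (y : nat -> R) :
  r <> 0 -> r ^ 2 = A * r - K * D ^ 2 -> cf_rec A K D y ->
  perturbed_rec (K * D ^ 2 / r ^ 2) (K * (D - 1) / r ^ 2) (normalized r y).
Proof.
  intros hr hroot hy n.
  rewrite gap_eq; pose proof (pos_INR n).
  replace (1 + K * D ^ 2 / r ^ 2) with (A / r)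
    by (apply (Rmult_eq_reg_r (r ^ 2)); [field_simplify; [lra| |]|]; auto using pow_nonzero).
  unfold normalized; rewrite hy, !fact_simpl, !mult_INR, !S_INR.
  simpl pow; field; repeat split; try lra; auto using pow_nonzero.
  apply INR_fact_neq_0.
Qed.

(** This is [K / r^2] times the sum of [D^2] and a positive number, so the sign of [K] does not
    matter. A Casoratian that is nonzero at the start thus never vanishes. *)
Lemma normalized_factor_neq0 (K D r : R) (n : nat) :
  K <> 0 -> 2 <= D -> r <> 0 ->
  K * D ^ 2 / r ^ 2 + K * (D - 1) / r ^ 2 * gap n <> 0.
Proof.
  intros hK hD hr; rewrite gap_eq; pose proof (pos_INR n) as hn.
  replace (K * D ^ 2 / r ^ 2
           + K * (D - 1) / r ^ 2 * / ((INR n + 1) * (INR n + 2)))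
    with (K / r ^ 2 * (D ^ 2 + (D - 1) * / ((INR n + 1) * (INR n + 2))))
    by (field; repeat split; lra).
  apply Rmult_integral_contrapositive_currified.
  - apply Rmult_integral_contrapositive_currified; [exact hK|].
    apply Rinv_neq_0_compat, pow_nonzero, hr.
  - assert (0 < / ((INR n + 1) * (INR n + 2)))
      by (apply Rinv_0_lt_compat, Rmult_lt_0_compat; lra).
    assert (0 < (D - 1) * / ((INR n + 1) * (INR n + 2)))
      by (apply Rmult_lt_0_compat; lra).
    nra.
Qed.

(** [p(1) q(0) - p(0) q(1) = b0], and the one step of the recurrence that leads to the shifted index
    multiplies it by [K (D - 1)]. *)
Lemma convergents_casoratian (A K D a1 b0 r : R) :
  K <> 0 -> 2 <= D -> b0 <> 0 -> r <> 0 ->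
  casoratian (normalized r (Cp A K D a1 b0)) (normalized r (Cq A K D a1 b0)) 0
  <> 0.
Proof.
  intros hK hD hb hr; unfold casoratian, normalized.
  rewrite (Cp_rec A K D a1 b0 0%nat), (Cq_rec A K D a1 b0 0%nat).
  change (Cp A K D a1 b0 1%nat) with (0 * a1 + b0).
  change (Cp A K D a1 b0 0%nat) with 0.
  change (Cq A K D a1 b0 1%nat) with a1.
  change (Cq A K D a1 b0 0%nat) with 1.
  simpl.
  match goal with |- ?t <> 0 =>
    replace t with (b0 * K * (D - 1) / r ^ 3) by (field; exact hr) end.
  repeat apply Rmult_integral_contrapositive_currified; try lra.
  apply Rinv_neq_0_compat, (pow_nonzero r 3), hr.
Qed.

(** The other root is [R' = (A - s) / 2] with [R R' = K D^2], so the quotient is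
    [R' / R = (A - s) / (A + s)]; and [|A - s| < A + s] for either sign of [K]. *)
Lemma Rroot_spec (A K D : R) :
  0 < A -> 2 <= D -> 0 < A ^ 2 - 4 * K * D ^ 2 ->
  0 < Rroot A K D /\ Rroot A K D ^ 2 = A * Rroot A K D - K * D ^ 2 /\
  Rabs (K * D ^ 2 / Rroot A K D ^ 2) < 1.
Proof.
  intros hA hD hd; unfold Rroot.
  pose proof (sqrt_lt_R0 _ hd) as hs.
  pose proof (pow2_sqrt _ (Rlt_le _ _ hd)) as hs2.
  set (s := sqrt (A ^ 2 - 4 * K * D ^ 2)) in *.
  assert (hK : K * D ^ 2 = (A - s) * (A + s) / 4) by (field_simplify; lra).
  split; [lra|split].
  - rewrite hK; field.
  - rewrite hK.
    replace ((A - s) * (A + s) / 4 / ((A + s) / 2) ^ 2) with ((A - s) / (A + s))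
      by (field; lra).
    rewrite Rabs_div, (Rabs_pos_eq (A + s)) by lra.
    apply Rlt_div_l; [lra|].
    apply Rabs_def1; lra.
Qed.

(** Index [0] is left out because comparison sequences such as [- INR n * ln (Rabs E) / 2] vanish
    there. *)
Lemma equiv_seq_of_ratio (f g : nat -> R) :
  (forall n, g (S n) <> 0) -> is_lim_seq (fun n => f (S n) / g (S n)) 1 ->
  equiv_seq f g.
Proof.
  intros hg hf eps; pose proof (cond_pos eps) as hp.
  destruct (is_lim_seq_eventually _ _ eps hf hp) as [N HN].
  exists (S N); intros [|n] hn; [lia|].
  specialize (HN n ltac:(lia)); specialize (hg n).
  change (Rabs (g (S n) + - f (S n)) <= eps * Rabs (g (S n))).
  replace (g (S n) + - f (S n)) with (- (f (S n) / g (S n) - 1) * g (S n))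
    by (field; exact hg).
  rewrite Rabs_mult, Rabs_Ropp.
  apply Rmult_le_compat_r; [apply Rabs_pos|lra].
Qed.

Lemma is_lim_seq_0_of_geometric (e c : R) (f : nat -> R) :
  Rabs e < 1 -> e <> 0 -> is_lim_seq (fun n => f n / e ^ n) c -> is_lim_seq f 0.
Proof.
  intros he he0 hf.
  apply is_lim_seq_ext with (fun n => f n / e ^ n * e ^ n).
  - intros n; field; apply pow_nonzero, he0.
  - replace (Finite 0) with (Finite (c * 0)) by (f_equal; ring).
    apply is_lim_seq_mult'; [exact hf|apply is_lim_seq_geom, he].
Qed.

Lemma is_lim_seq_sub0 (x : nat -> R) (L : R) :
  is_lim_seq (fun n => L - x n) 0 -> is_lim_seq x L.
Proof.
  intros h; apply is_lim_seq_ext with (fun n => L - (L - x n)).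
  - intros n; ring.
  - replace (Finite L) with (Finite (L - 0)) by (f_equal; ring).
    apply is_lim_seq_minus'; [apply is_lim_seq_const|exact h].
Qed.

(** That [v n / u n] tends to [0] would not suffice: by the convention [x / 0 = 0], a vanishing
    [v n] makes [Rabs (u n / v n)] equal to [0]. The nonzero [c] excludes this for large [n]. *)
Lemma abs_ratio_pinfty (u v : nat -> R) (c e : R) :
  Rabs e < 1 -> e <> 0 -> c <> 0 ->
  is_lim_seq (fun n => v n / u n / e ^ n) c ->
  is_lim_seq (fun n => Rabs (u n / v n)) p_infty.
Proof.
  intros he he0 hc h.
  pose proof (is_lim_seq_0_of_geometric e c _ he he0 h) as h0.
  apply is_lim_seq_spec; intros M.
  destruct (is_lim_seq_neq0_eventually _ _ h hc) as [N1 H1].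
  destruct (is_lim_seq_eventually _ _ (/ (Rabs M + 1)) h0) as [N2 H2].
  { pose proof (Rabs_pos M); apply Rinv_0_lt_compat; lra. }
  exists (N1 + N2)%nat; intros n hn.
  specialize (H1 n ltac:(lia)); specialize (H2 n ltac:(lia)).
  rewrite Rminus_0_r in H2.
  assert (hvu : v n / u n <> 0).
  { intros hz; apply H1; rewrite hz; unfold Rdiv; ring. }
  replace (u n / v n) with (/ (v n / u n)).
  - rewrite Rabs_inv.
    apply Rle_lt_trans with (1 := Rle_abs M).
    pose proof (Rabs_pos M); pose proof (Rabs_pos_lt _ hvu).
    apply Rlt_le_trans with (Rabs M + 1); [lra|].
    rewrite <- (Rinv_inv (Rabs M + 1)).
    apply Rinv_le_contravar; lra.
  - unfold Rdiv; rewrite Rinv_mult, Rinv_inv; ring.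
Qed.

Lemma convergent_ratio_cv (A K D a1 b0 : R) :
  0 < A -> K <> 0 -> 2 <= D -> 0 < A ^ 2 - 4 * K * D ^ 2 -> b0 <> 0 ->
  ~ is_lim_seq (fun n => Rabs (Cp A K D a1 b0 n / Cq A K D a1 b0 n)) p_infty ->
  let r := Rroot A K D in
  let e := K * D ^ 2 / r ^ 2 in
  let u := normalized r (Cp A K D a1 b0) in
  let v := normalized r (Cq A K D a1 b0) in
  exists V L c : R, V <> 0 /\ c <> 0 /\ is_lim_seq v V /\
    is_lim_seq (fun n => (L - u n / v n) / e ^ n) c.
Proof.
  intros hA hK hD hd hb hinf r e u v.
  destruct (Rroot_spec A K D hA hD hd) as [hr [hroot he]].
  fold r in hr, hroot, he; fold e in he.
  assert (hr0 : r <> 0) by lra.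
  assert (he0 : e <> 0).
  { unfold e; apply Rmult_integral_contrapositive_currified;
      [|apply Rinv_neq_0_compat, pow_nonzero, hr0].
    apply Rmult_integral_contrapositive_currified; [exact hK|].
    apply pow_nonzero; lra. }
  pose proof (normalized_rec A K D r _ hr0 hroot (Cp_rec A K D a1 b0)) as hu.
  pose proof (normalized_rec A K D r _ hr0 hroot (Cq_rec A K D a1 b0)) as hv.
  fold u in hu; fold v in hv; fold e in hu, hv.
  pose proof (fun n => normalized_factor_neq0 K D r n hK hD hr0) as hn.
  fold e in hn.
  pose proof (convergents_casoratian A K D a1 b0 r hK hD hb hr0) as hW.
  fold u v in hW.
  destruct (perturbed_rec_cv _ _ v he hv) as [V [hV _]].
  destruct (perturbed_rec_cv _ _ u he hu) as [U [hU _]].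
  destruct (Req_dec V 0) as [V0|V0].
  (* If [q] has normalized limit [0], then [p] is dominant. With the roles exchanged, [q / p] tends
     to [0] at the exact rate [e ^ n]. *)
  - exfalso; apply hinf.
    assert (U0 : U <> 0).
    { intros U0; subst.
      apply (dominant_solution _ _ u v he hu hv); auto.
      apply (casoratian_neq0 _ _ u v hu hv hn hW). }
    destruct (solution_ratio_cv _ _ v u U he he0 hv hu hn) as [L [c [hc hL]]]; auto.
    { intros h; apply hW; apply Ropp_eq_0_compat in h.
      rewrite <- h; unfold casoratian; ring. }
    assert (L0 : L = 0).
    { pose proof (is_lim_seq_sub0 _ _ (is_lim_seq_0_of_geometric _ _ _ he he0 hL)) as h1.
      pose proof (is_lim_seq_div' _ _ _ _ hV hU U0) as h2.
      apply is_lim_seq_unique in h1; apply is_lim_seq_unique in h2.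
      rewrite h1 in h2; injection h2; intros ->; rewrite V0; unfold Rdiv; ring. }
    apply (is_lim_seq_incr_1
             (fun n => Rabs (Cp A K D a1 b0 n / Cq A K D a1 b0 n))).
    apply is_lim_seq_ext with (fun n => Rabs (u n / v n)).
    + intros n; unfold u, v; rewrite normalized_ratio by exact hr0; reflexivity.
    + apply abs_ratio_pinfty with (- c) e; auto; [lra|].
      apply is_lim_seq_ext with (fun n => - ((L - v n / u n) / e ^ n)).
      * intros n; rewrite L0; unfold Rdiv; ring.
      * apply (is_lim_seq_opp _ (Finite c)), hL.
  - destruct (solution_ratio_cv _ _ u v V he he0 hu hv hn hW hV V0)
      as [L [c [hc hL]]].
    exists V, L, c; auto.
Qed.

(** * Logarithmic size of the normalized remainders *)

(** Each factor lies between [D (j - 1)] and [D j], except that the first one, [1], is kept in the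
    lower bound. The bounds differ only by the factor [D (n + 1)], so that on the logarithmic scale
    factorials cancel without Stirling's formula. *)
Lemma prod1_linear_bounds (D : R) (n : nat) :
  1 <= D ->
  D ^ n * INR (fact n) <= prod1 (fun j => D * (INR j - 1) + 1) (S n)
    <= D ^ S n * INR (fact (S n)).
Proof.
  intros hD; induction n as [|n [IH1 IH2]].
  - simpl; lra.
  - assert (h0 : 0 <= D ^ n * INR (fact n)).
    { apply Rmult_le_pos; [apply pow_le; lra|apply pos_INR]. }
    change (prod1 (fun j => D * (INR j - 1) + 1) (S (S n)))
      with (prod1 (fun j => D * (INR j - 1) + 1) (S n)
            * (D * (INR (S (S n)) - 1) + 1)).
    set (P := prod1 _ (S n)) in *.
    rewrite (fact_simpl (S n)), (mult_INR (S (S n))).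
    change (D ^ S (S n)) with (D * D ^ S n).
    rewrite (S_INR (S n)); split.
    + rewrite fact_simpl, mult_INR; change (D ^ S n) with (D * D ^ n).
      pose proof (pos_INR (S n)).
      replace (D * D ^ n * (INR (S n) * INR (fact n)))
        with (D ^ n * INR (fact n) * (D * INR (S n))) by ring.
      apply Rmult_le_compat; [exact h0| |exact IH1|nra].
      apply Rmult_le_pos; lra.
    + pose proof (pos_INR (S n)).
      replace (D * D ^ S n * ((INR (S n) + 1) * INR (fact (S n))))
        with (D ^ S n * INR (fact (S n)) * (D * (INR (S n) + 1))) by ring.
      apply Rmult_le_compat; [lra|nra|exact IH2|nra].
Qed.

Lemma fnorm_log_bound (K D : R) (n : nat) :
  K <> 0 -> 1 <= D ->
  0 < fnorm K D (S n) /\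
  Rabs (ln (INR (fact n)) - ln (fnorm K D (S n))
        + (INR n + 1) * (ln D + ln (Rabs K) / 2))
  <= ln D + Rabs (ln (Rabs K)) + ln (INR n + 1).
Proof.
  intros hK hD.
  pose proof (Rabs_pos_lt _ hK) as hK'.
  pose proof (INR_fact_lt_0 n) as hf.
  pose proof (pos_INR n) as hn.
  destruct (prod1_linear_bounds D n hD) as [h1 h2].
  unfold fnorm; set (P := prod1 _ (S n)) in *.
  assert (hDn : forall k, 0 < D ^ k) by (intros k; apply pow_lt; lra).
  assert (hP : 0 < P).
  { apply Rlt_le_trans with (2 := h1), Rmult_lt_0_compat; auto. }
  split; [apply Rmult_lt_0_compat; [apply pow_lt|]; assumption|].
  rewrite ln_mult by (try apply pow_lt; assumption).
  rewrite ln_pow by exact hK'.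
  apply ln_le in h1; [|apply Rmult_lt_0_compat; auto].
  apply ln_le in h2; [|exact hP].
  rewrite fact_simpl, mult_INR, S_INR in h2.
  rewrite ln_mult in h1 by auto.
  rewrite ln_mult, ln_mult in h2 by (auto; try lra; apply Rmult_lt_0_compat; lra).
  rewrite !ln_pow in h1, h2 by lra.
  rewrite S_INR in h2.
  assert (hlD : 0 <= ln D) by (rewrite <- ln_1; apply ln_le; lra).
  assert (hln : 0 <= ln (INR n + 1)) by (rewrite <- ln_1; apply ln_le; lra).
  (* The floor changes the exponent of [Rabs K] by at most [1], which accounts for the term
     [Rabs (ln (Rabs K))] of the bound. *)
  assert (hm : Rabs ((INR n + 1) / 2 - INR (Nat.div (S n) 2)) <= 1).
  { pose proof (Nat.div_mod_eq (S n) 2) as hdm.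
    pose proof (Nat.mod_upper_bound (S n) 2 ltac:(lia)) as hmb.
    set (m := (S n mod 2)%nat) in *; set (k := (S n / 2)%nat) in *.
    apply (f_equal INR) in hdm.
    rewrite plus_INR, mult_INR, S_INR in hdm; simpl (INR 2) in hdm.
    assert (0 <= INR m <= 1).
    { split; [apply pos_INR|]. change 1 with (INR 1); apply le_INR; lia. }
    apply Rabs_le; lra. }
  apply (Rmult_le_compat_r (Rabs (ln (Rabs K)))) in hm; [|apply Rabs_pos].
  rewrite <- Rabs_mult, Rmult_1_l in hm.
  replace (ln (INR (fact n)) - (INR (S n / 2) * ln (Rabs K) + ln P)
           + (INR n + 1) * (ln D + ln (Rabs K) / 2))
    with (((INR n + 1) / 2 - INR (S n / 2)) * ln (Rabs K)
          + (ln (INR (fact n)) + (INR n + 1) * ln D - ln P)) by field.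
  apply Rle_trans with (1 := Rabs_triang _ _).
  assert (Rabs (ln (INR (fact n)) + (INR n + 1) * ln D - ln P)
          <= ln D + ln (INR n + 1)) by (apply Rabs_le; lra).
  lra.
Qed.

Lemma is_lim_seq_ln_div (C : R) :
  is_lim_seq (fun n => (C + ln (INR n + 1)) / (INR n + 1)) 0.
Proof.
  apply is_lim_seq_ext
    with (fun n => C / (INR n + 1) + ln (INR (S n)) / INR (S n)).
  - intros n; rewrite S_INR; pose proof (pos_INR n); field; lra.
  - replace (Finite 0) with (Finite (0 + 0)) by (f_equal; ring).
    apply is_lim_seq_plus'; [apply is_lim_seq_const_div_succ|].
    apply (is_lim_comp_seq (fun x => ln x / x) (fun n => INR (S n)) p_infty 0).
    + exact is_lim_div_ln_p.
    + exists 0%nat; intros n _; discriminate.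
    + apply (is_lim_seq_incr_1 INR), is_lim_seq_INR.
Qed.

(** By [fnorm_log_bound], [n! / f(n+1)] is the power [-(n+1)] of [D sqrt|K|] up to a polynomial
    factor, and [r |e| / (D sqrt|K|) = |E|^(-1/2)]. A nonzero limit of [t] keeps its logarithm
    bounded, so the total error is [O(log n)]. *)
Lemma log_equiv (K D r t0 : R) (y t : nat -> R) :
  K <> 0 -> 2 <= D -> 0 < r ->
  let e := K * D ^ 2 / r ^ 2 in
  let E := r ^ 2 / (K * D ^ 2) in
  Rabs e < 1 -> t0 <> 0 -> is_lim_seq t t0 ->
  (forall n, y (S n)
     = INR (fact n) * r ^ S n * e ^ n * t n / fnorm K D (S n)) ->
  equiv_seq (fun n => ln (Rabs (y n))) (fun n => - INR n * ln (Rabs E) / 2).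
Proof.
  intros hK hD hr e E he ht0 ht hy.
  pose proof (Rabs_pos_lt _ hK) as hK'.
  pose proof (pow_lt D 2 ltac:(lra)) as hD2.
  pose proof (pow_lt r 2 hr) as hr2.
  assert (hKD : K * D ^ 2 <> 0)
    by (apply Rmult_integral_contrapositive_currified; lra).
  assert (he0 : e <> 0)
    by (apply Rmult_integral_contrapositive_currified;
        [|apply Rinv_neq_0_compat]; lra).
  pose proof (Rabs_pos_lt _ he0) as he'.
  assert (heE : Rabs E = / Rabs e).
  { rewrite <- Rabs_inv; f_equal; unfold E, e; field; lra. }
  assert (hE : ln (Rabs E) = 2 * ln r - ln (Rabs K) - 2 * ln D).
  { unfold E; rewrite Rabs_div, Rabs_mult by exact hKD.
    rewrite (Rabs_pos_eq (r ^ 2)), (Rabs_pos_eq (D ^ 2)) by lra.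
    rewrite ln_div, ln_mult, !ln_pow by (try apply Rmult_lt_0_compat; lra).
    simpl INR; lra. }
  assert (hle : ln (Rabs e) = - ln (Rabs E)) by (rewrite heE, ln_Rinv; lra).
  assert (hl : 0 < ln (Rabs E)).
  { pose proof (ln_increasing _ _ he' he) as h; rewrite ln_1 in h; lra. }
  set (l := ln (Rabs E)) in *.
  apply equiv_seq_of_ratio.
  { intros n; rewrite S_INR; pose proof (pos_INR n); nra. }
  set (z := fun n => ln (Rabs (y (S n))) + (INR n + 1) * l / 2).
  set (C := ln D + Rabs (ln (Rabs K)) + l + (Rabs (ln (Rabs t0)) + 1)).
  assert (hz : eventually (fun n => Rabs (z n) <= C + ln (INR n + 1))).
  { assert (hlt : is_lim_seq (fun n => ln (Rabs (t n))) (ln (Rabs t0))).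
    { apply (is_lim_seq_continuous ln (fun n => Rabs (t n))).
      - apply derivable_continuous_pt; exists (/ Rabs t0).
        apply derivable_pt_lim_ln, Rabs_pos_lt, ht0.
      - apply (is_lim_seq_abs _ (Finite t0)), ht. }
    destruct (is_lim_seq_eventually _ _ 1 hlt Rlt_0_1) as [N1 H1].
    destruct (is_lim_seq_neq0_eventually _ _ ht ht0) as [N2 H2].
    exists (N1 + N2)%nat; intros n hn.
    specialize (H1 n ltac:(lia)); specialize (H2 n ltac:(lia)).
    pose proof (Rabs_pos_lt _ H2) as ht'.
    destruct (fnorm_log_bound K D n hK ltac:(lra)) as [hf hb].
    pose proof (INR_fact_lt_0 n) as hfact.
    pose proof (pow_lt r (S n) hr) as hrn.
    pose proof (pow_lt _ n he') as hen.
    assert (hly : z n = (ln (INR (fact n)) - ln (fnorm K D (S n))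
                         + (INR n + 1) * (ln D + ln (Rabs K) / 2))
                        + l + ln (Rabs (t n))).
    { unfold z; rewrite hy.
      rewrite Rabs_div, !Rabs_mult, <- (RPow_abs e) by lra.
      rewrite (Rabs_pos_eq (INR (fact n))), (Rabs_pos_eq (r ^ S n)),
        (Rabs_pos_eq (fnorm K D (S n))) by lra.
      rewrite ln_div, !ln_mult, !ln_pow, hle, S_INR
        by (repeat (assumption || apply Rmult_lt_0_compat)).
      fold l; replace (ln r) with ((l + ln (Rabs K) + 2 * ln D) / 2) by lra.
      field. }
    rewrite hly; unfold C.
    apply Rle_trans with (1 := Rabs_triang _ _).
    assert (h3 : Rabs (ln (Rabs (t n))) <= Rabs (ln (Rabs t0)) + 1).
    { replace (ln (Rabs (t n)))
        with (ln (Rabs t0) + (ln (Rabs (t n)) - ln (Rabs t0))) by ring.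
      apply Rle_trans with (1 := Rabs_triang _ _); lra. }
    pose proof (Rabs_triang (ln (INR (fact n)) - ln (fnorm K D (S n))
                         + (INR n + 1) * (ln D + ln (Rabs K) / 2)) l) as h4.
    rewrite (Rabs_pos_eq l) in h4 by lra.
    lra. }
  assert (hz0 : is_lim_seq (fun n => z n / (INR n + 1)) 0).
  { apply is_lim_seq_abs_0.
    apply is_lim_seq_le_le_loc
      with (fun _ => 0) (fun n => (C + ln (INR n + 1)) / (INR n + 1)).
    - destruct hz as [N HN]; exists N; intros n hn; specialize (HN n hn).
      pose proof (pos_INR n).
      split; [apply Rabs_pos|].
      rewrite Rabs_div, (Rabs_pos_eq (INR n + 1)) by lra.
      apply Rmult_le_compat_r; [|exact HN].
      apply Rlt_le, Rinv_0_lt_compat; lra.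
    - apply is_lim_seq_const.
    - apply is_lim_seq_ln_div. }
  apply is_lim_seq_ext with (fun n => 1 - 2 / l * (z n / (INR n + 1))).
  - intros n; unfold z; rewrite S_INR; pose proof (pos_INR n); field; lra.
  - replace (Finite 1) with (Finite (1 - 2 / l * 0)) by (f_equal; ring).
    apply is_lim_seq_minus'; [apply is_lim_seq_const|].
    apply (is_lim_seq_scal_l _ (2 / l) 0), hz0.
Qed.

Lemma convergents_asymptotics (A K D a1 b0 : R) :
  0 < A -> K <> 0 -> 2 <= D -> 0 < A ^ 2 - 4 * K * D ^ 2 -> b0 <> 0 ->
  ~ is_lim_seq (fun n => Rabs (Cp A K D a1 b0 n / Cq A K D a1 b0 n)) p_infty ->
  let p := Cp A K D a1 b0 in
  let q := Cq A K D a1 b0 in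
  let E := Erate A K D in
  exists L C1 C2 : R,
    converges_exponentially (fun n => p n / q n) L /\
    C1 <> 0 /\ C2 <> 0 /\
    is_lim_seq (normalized (Rroot A K D) q) C2 /\
    equiv_seq (fun n => L - p n / q n) (fun n => C1 / E ^ n) /\
    equiv_seq q (fun n => C2 * INR (fact (n - 1)) * Rroot A K D ^ n) /\
    equiv_seq (fun n => ln (Rabs (q n / fnorm K D n * L - p n / fnorm K D n)))
              (fun n => - INR n * ln (Rabs E) / 2).
Proof.
  intros hA hK hD hd hb hinf p q E.
  destruct (convergent_ratio_cv A K D a1 b0 hA hK hD hd hb hinf)
    as [V [L [c [hV [hc [hvV hL]]]]]].
  destruct (Rroot_spec A K D hA hD hd) as [hr [hroot he]].
  fold p in hL; fold q in hL, hvV.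
  unfold Erate in E.
  set (r := Rroot A K D) in *.
  set (e := K * D ^ 2 / r ^ 2) in *.
  pose proof (pow_lt D 2 ltac:(lra)) as hD2.
  pose proof (pow_lt r 2 hr) as hr2.
  assert (hKD : K * D ^ 2 <> 0)
    by (apply Rmult_integral_contrapositive_currified; lra).
  assert (he0 : e <> 0)
    by (apply Rmult_integral_contrapositive_currified;
        [|apply Rinv_neq_0_compat]; lra).
  assert (hEe : E = / e) by (unfold E, e; field; lra).
  assert (hL' : is_lim_seq (fun n => (L - p (S n) / q (S n)) / e ^ n) c).
  { apply is_lim_seq_ext with (2 := hL); intros n.
    rewrite normalized_ratio by lra; reflexivity. }
  (* The error at index [S n] is measured against [e ^ n]; rewriting it against [E ^ S n] costs the
     factor [1 / e]. *)
  exists L, (c / e), V.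
  split; [|split; [|split; [exact hV|split; [exact hvV|split; [|split]]]]].
  - split.
    + apply (is_lim_seq_incr_1 (fun n => p n / q n)), is_lim_seq_sub0.
      apply (is_lim_seq_0_of_geometric e c); assumption.
    + exists ((Rabs c + 1) / Rabs e), (Rabs e).
      split; [split; [apply Rabs_pos|exact he]|].
      destruct (is_lim_seq_eventually _ _ 1 hL' Rlt_0_1) as [N HN].
      exists (S N); intros [|n] hn; [lia|].
      specialize (HN n ltac:(lia)).
      pose proof (Rabs_pos_lt _ he0) as he'.
      pose proof (pow_lt _ n he') as hen.
      assert (h : Rabs ((L - p (S n) / q (S n)) / e ^ n) <= Rabs c + 1).
      { replace ((L - p (S n) / q (S n)) / e ^ n)
          with (c + ((L - p (S n) / q (S n)) / e ^ n - c)) by ring.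
        apply Rle_trans with (1 := Rabs_triang _ _); lra. }
      rewrite Rabs_div, <- (RPow_abs e n) in h by (apply pow_nonzero, he0).
      apply Rle_div_l in h; [|exact hen].
      replace ((Rabs c + 1) / Rabs e * Rabs e ^ S n)
        with ((Rabs c + 1) * Rabs e ^ n) by (simpl; field; lra).
      exact h.
  - apply Rmult_integral_contrapositive_currified; auto using Rinv_neq_0_compat.
  - assert (hEn : forall n, E ^ n = / e ^ n)
      by (intros n; rewrite hEe, pow_inv; reflexivity).
    apply equiv_seq_of_ratio.
    + intros n; rewrite hEn; unfold Rdiv; rewrite Rinv_inv.
      apply Rmult_integral_contrapositive_currified;
        [|apply pow_nonzero, he0].
      apply Rmult_integral_contrapositive_currified;
        auto using Rinv_neq_0_compat.
    + apply is_lim_seq_ext with (fun n => (L - p (S n) / q (S n)) / e ^ n * / c).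
      * intros n; rewrite hEn; set (x := p (S n) / q (S n)).
        simpl; field; repeat split; auto using pow_nonzero.
      * rewrite <- (Rinv_r c hc).
        apply is_lim_seq_mult'; [exact hL'|apply is_lim_seq_const].
  - apply equiv_seq_of_ratio.
    + intros n; simpl Nat.sub; rewrite Nat.sub_0_r.
      apply Rmult_integral_contrapositive_currified; [|apply pow_nonzero; lra].
      apply Rmult_integral_contrapositive_currified;
        auto using INR_fact_neq_0.
    + apply is_lim_seq_ext with (fun n => normalized r q n * / V).
      * intros n; simpl Nat.sub; rewrite Nat.sub_0_r; unfold normalized.
        field; repeat split; auto using INR_fact_neq_0.
        apply pow_nonzero; lra.
      * rewrite <- (Rinv_r V hV).
        apply is_lim_seq_mult'; [exact hvV|apply is_lim_seq_const].
  - destruct (is_lim_seq_neq0_eventually _ _ hvV hV) as [N HN].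
    set (y := fun n => q n / fnorm K D n * L - p n / fnorm K D n).
    assert (hf : forall n, fnorm K D (S n) <> 0).
    { intros n; destruct (fnorm_log_bound K D n hK ltac:(lra)); lra. }
    set (w := fun n => INR (fact n) * r ^ S n * e ^ n).
    assert (hw : forall n, w n <> 0).
    { intros n; unfold w; apply Rmult_integral_contrapositive_currified;
        [|apply pow_nonzero, he0].
      apply Rmult_integral_contrapositive_currified;
        [apply INR_fact_neq_0|apply pow_nonzero; lra]. }
    apply (log_equiv K D r (V * c) y (fun n => y (S n) * fnorm K D (S n) / w n));
      try assumption.
    + apply Rmult_integral_contrapositive_currified; assumption.
    (* As [q L - p = q (L - p / q)] wherever [q] is nonzero, the limit is the product of the limits
       found for [q] and for the error. *)
    + apply is_lim_seq_ext_loc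
        with (fun n => normalized r q n * ((L - p (S n) / q (S n)) / e ^ n)).
      * exists N; intros n hn; specialize (HN n hn).
        assert (hq : q (S n) <> 0).
        { intros h; apply HN; unfold normalized; rewrite h; unfold Rdiv; ring. }
        assert (hrn : r ^ S n <> 0) by (apply pow_nonzero; lra).
        pose proof (pow_nonzero e n he0) as hen.
        specialize (hf n); unfold y, w, normalized.
        set (rn := r ^ S n) in *; set (en := e ^ n) in *.
        field; auto using INR_fact_neq_0.
      * apply is_lim_seq_mult'; assumption.
    + intros n.
      change (y (S n) = w n * (y (S n) * fnorm K D (S n) / w n) / fnorm K D (S n)).
      field; auto.
Qed.

(** * The Gamma function on the half-line *)

(** Integrals of a nonnegative function grow with the interval, so their supremum is the limit along
    both ends. The bound of compact integrals by [l] later yields positivity of [Gamma]. *)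
Lemma is_RInt_gen_nonneg_bounded (f : R -> R) (B : R) :
  (forall t, 0 < t -> continuous f t) ->
  (forall t, 0 < t -> 0 <= f t) ->
  (forall a b, 0 < a -> a <= b -> RInt f a b <= B) ->
  exists l : R, is_RInt_gen f (at_right 0) (Rbar_locally p_infty) l /\
    forall a b, 0 < a -> a <= b -> RInt f a b <= l.
Proof.
  intros hc hf hB.
  assert (hex : forall a b, 0 < a -> a <= b -> ex_RInt f a b).
  { intros a b ha hab; apply (@ex_RInt_continuous R_CompleteNormedModule).
    intros z hz; apply hc.
    rewrite Rmin_left in hz by exact hab; lra. }
  assert (hpos : forall a b, 0 < a -> a <= b -> 0 <= RInt f a b).
  { intros a b ha hab; apply RInt_ge_0; auto; intros t ht; apply hf; lra. }
  assert (hmono : forall a b a' b', 0 < a' -> a' <= a -> a <= b -> b <= b' ->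
            RInt f a b <= RInt f a' b').
  { intros a b a' b' h1 h2 h3 h4.
    pose proof (RInt_Chasles f a' a b' (hex a' a h1 h2) (hex a b' ltac:(lra) ltac:(lra))) as e1.
    pose proof (RInt_Chasles f a b b' (hex a b ltac:(lra) h3) (hex b b' ltac:(lra) h4)) as e2.
    rewrite <- e1, <- e2.
    pose proof (hpos a' a h1 h2); pose proof (hpos b b' ltac:(lra) h4).
    change plus with Rplus; lra. }
  destruct (completeness (fun y => exists a b, 0 < a /\ a <= b /\ y = RInt f a b))
    as [l [hub hlub]].
  - exists B; intros y (a & b & ha & hab & ->); auto.
  - exists (RInt f 1 1), 1, 1; repeat split; lra.
  - assert (hle : forall a b, 0 < a -> a <= b -> RInt f a b <= l).
    { intros a b ha hab; apply hub; exists a, b; auto. }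
    exists l; split; [|exact hle].
    intros P [eps HP]; unfold filtermapi.
    pose proof (cond_pos eps) as he.
    assert (h : exists a b, 0 < a /\ a <= b /\ l - eps < RInt f a b).
    { apply NNPP; intros hn.
      assert (l <= l - eps); [|lra].
      apply hlub; intros y (a & b & ha & hab & ->).
      apply Rnot_lt_le; intros hlt; apply hn; exists a, b; auto. }
    destruct h as (a & b & ha & hab & h).
    apply Filter_prod with (fun a' => 0 < a' < a) (fun b' => b < b').
    + exists (mkposreal a ha); intros y hy hy0.
      change (Rabs (y - 0) < a) in hy.
      rewrite Rminus_0_r, Rabs_pos_eq in hy; lra.
    + exists b; auto.
    + intros a' b' [h1 h2] h3; simpl.
      exists (RInt f a' b'); split.
      * apply (@RInt_correct R_CompleteNormedModule), hex; lra.
      * apply HP.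
        pose proof (hmono a b a' b' h1 ltac:(lra) hab ltac:(lra)).
        pose proof (hle a' b' h1 ltac:(lra)).
        change (Rabs (RInt f a' b' - l) < eps).
        apply Rabs_def1; lra.
Qed.

Definition gamma_integrand (x t : R) : R := Rpower t (x - 1) * exp (- t).

Lemma gamma_integrand_pos (x t : R) : 0 < gamma_integrand x t.
Proof. apply Rmult_lt_0_compat; apply exp_pos. Qed.

Lemma gamma_integrand_continuous (x t : R) :
  0 < t -> continuous (gamma_integrand x) t.
Proof.
  intros ht; apply (ex_derive_continuous (gamma_integrand x)).
  unfold gamma_integrand, Rpower; auto_derive; exact ht.
Qed.

(* [gamma_integrand x <= (4 / x) h'] for the bounded function
   [h t = (t / (1 + t)) ^ x], since [x <= 1] and [(1 + t) ^ 2 <= 4 exp t]. *)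
Lemma gamma_integral_bound (x a b : R) :
  0 < x <= 1 -> 0 < a -> a <= b -> RInt (gamma_integrand x) a b <= 4 / x.
Proof.
  intros hx ha hab.
  set (h := fun t => 4 / x * exp (x * (ln t - ln (1 + t)))).
  set (dh := fun t => 4 * exp (x * (ln t - ln (1 + t))) * (/ t - / (1 + t))).
  assert (hI : is_RInt dh a b (minus (h b) (h a))).
  { apply (@is_RInt_derive R_CompleteNormedModule); intros t;
      rewrite Rmin_left by exact hab; intros ht.
    - unfold h, dh; auto_derive; [repeat split; lra|]; unfold Rminus; field; repeat split; lra.
    - apply (ex_derive_continuous dh); unfold dh; auto_derive; repeat split; lra. }
  assert (hG : is_RInt (gamma_integrand x) a b (RInt (gamma_integrand x) a b)).
  { apply (@RInt_correct R_CompleteNormedModule),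
      (@ex_RInt_continuous R_CompleteNormedModule).
    intros t; rewrite Rmin_left by exact hab; intros ht.
    apply gamma_integrand_continuous; lra. }
  apply Rle_trans with (minus (h b) (h a)).
  - apply (is_RInt_le _ _ a b _ _ hab hG hI).
    intros t ht; unfold gamma_integrand, dh, Rpower.
    assert (h1 : exp (x * (ln t - ln (1 + t)))
                 = exp ((x - 1) * ln t) * t * exp (- (x * ln (1 + t)))).
    { replace (x * (ln t - ln (1 + t)))
        with ((x - 1) * ln t + ln t + - (x * ln (1 + t))) by ring.
      rewrite !exp_plus, exp_ln by lra; reflexivity. }
    assert (h2 : / (1 + t) <= exp (- (x * ln (1 + t)))).
    { assert (0 <= ln (1 + t)) by (rewrite <- ln_1; apply ln_le; lra).
      apply Rle_trans with (exp (- ln (1 + t))).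
      - rewrite exp_Ropp, exp_ln by lra; apply Rle_refl.
      - apply exp_le_compat; nra. }
    assert (h3 : exp (- t) <= 4 * (/ (1 + t) * / (1 + t))).
    { assert (h4 : (1 + t) * (1 + t) / 4 <= exp t).
      { replace (exp t) with (exp (t / 2) * exp (t / 2))
          by (rewrite <- exp_plus; f_equal; field).
        pose proof (exp_ineq1_le (t / 2)); nra. }
      rewrite exp_Ropp.
      replace (4 * (/ (1 + t) * / (1 + t))) with (/ ((1 + t) * (1 + t) / 4))
        by (field; lra).
      apply Rinv_le_contravar; nra. }
    rewrite h1; set (g := exp ((x - 1) * ln t)); set (k := exp (- (x * _))) in *.
    assert (hg : 0 < g) by apply exp_pos.
    replace (4 * (g * t * k) * (/ t - / (1 + t))) with (g * (4 * (k * / (1 + t))))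
      by (field; lra).
    apply Rmult_le_compat_l; [lra|].
    apply Rle_trans with (1 := h3).
    assert (0 < / (1 + t)) by (apply Rinv_0_lt_compat; lra); nra.
  - assert (hx4 : 0 < 4 / x) by (apply Rdiv_lt_0_compat; lra).
    assert (h b <= 4 / x * 1).
    { unfold h; apply Rmult_le_compat_l; [lra|].
      apply Rle_trans with (exp 0); [apply exp_le_compat|rewrite exp_0; lra].
      assert (ln b <= ln (1 + b)) by (apply ln_le; lra); nra. }
    assert (0 < h a) by (apply Rmult_lt_0_compat; [exact hx4|apply exp_pos]).
    unfold minus; change plus with Rplus; change opp with Ropp; lra.
Qed.

(** The arguments of [Gamma] that occur are [1/2], [1 - 1/D], [1] and integer shifts of these, so
    this range together with integration by parts covers them all. *)
Lemma is_RInt_gen_Gamma_base (x : R) :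
  0 < x <= 1 ->
  exists l : R, 0 < l /\
    is_RInt_gen (gamma_integrand x) (at_right 0) (Rbar_locally p_infty) l.
Proof.
  intros hx.
  destruct (is_RInt_gen_nonneg_bounded (gamma_integrand x) (4 / x)) as [l [hl hle]].
  - apply gamma_integrand_continuous.
  - intros t _; apply Rlt_le, gamma_integrand_pos.
  - intros a b ha hab; apply gamma_integral_bound; assumption.
  - exists l; split; [|exact hl].
    apply Rlt_le_trans with (RInt (gamma_integrand x) 1 2).
    + apply RInt_gt_0; [lra|intros; apply gamma_integrand_pos|].
      intros t ht; apply gamma_integrand_continuous; lra.
    + apply hle; lra.
Qed.

Lemma at_right_0_eventually (d : R) (P : R -> Prop) :
  0 < d -> (forall t, 0 < t < d -> P t) -> at_right 0 P.
Proof.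
  intros hd hP; exists (mkposreal d hd); intros t ht ht0; apply hP.
  change (Rabs (t - 0) < d) in ht.
  rewrite Rminus_0_r, Rabs_pos_eq in ht; lra.
Qed.

Lemma Rpower_exp_cv_0 (x : R) :
  0 < x -> filterlim (fun t => - (Rpower t x * exp (- t))) (at_right 0) (locally 0).
Proof.
  intros hx P [eps HP]; pose proof (cond_pos eps) as he.
  apply (at_right_0_eventually (Rpower eps (/ x))); [apply exp_pos|].
  intros t [h0 h1]; apply HP.
  change (Rabs (- (Rpower t x * exp (- t)) - 0) < eps).
  rewrite Rminus_0_r, Rabs_Ropp, Rabs_pos_eq
    by (apply Rmult_le_pos; apply Rlt_le, exp_pos).
  assert (h2 : Rpower t x < eps).
  { rewrite <- (Rpower_1 eps), <- (Rinv_l x), <- Rpower_mult by lra.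
    unfold Rpower at 1 2; apply exp_increasing, Rmult_lt_compat_l; [exact hx|].
    apply ln_increasing; assumption. }
  assert (h3 : exp (- t) < 1) by (rewrite <- exp_0; apply exp_increasing; lra).
  pose proof (exp_pos (- t)); pose proof (exp_pos (x * ln t)).
  unfold Rpower in *; nra.
Qed.

Lemma Rpower_exp_cv_infty (x : R) :
  0 < x ->
  filterlim (fun t => - (Rpower t x * exp (- t))) (Rbar_locally p_infty) (locally 0).
Proof.
  intros hx P [eps HP]; pose proof (cond_pos eps) as he.
  pose proof is_lim_div_ln_p as hlim; apply is_lim_spec in hlim.
  assert (hd : 0 < / (2 * x)) by (apply Rinv_0_lt_compat; lra).
  destruct (hlim (mkposreal _ hd)) as [M HM]; simpl in HM.
  (* Past [M], [x ln t < t / 2]; past [- 2 ln eps], [- t / 2 < ln eps]; the bound [1] keeps [t]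
     positive. Together, [x ln t - t < ln eps]. *)
  exists (Rmax M (Rmax 1 (- 2 * ln eps))); intros t ht.
  apply Rmax_Rlt in ht; destruct ht as [hM ht].
  apply Rmax_Rlt in ht; destruct ht as [h1 h2].
  apply HP; change (Rabs (- (Rpower t x * exp (- t)) - 0) < eps).
  rewrite Rminus_0_r, Rabs_Ropp, Rabs_pos_eq
    by (apply Rmult_le_pos; apply Rlt_le, exp_pos).
  specialize (HM t hM); rewrite Rminus_0_r in HM.
  apply Rle_lt_trans with (1 := Rle_abs _) in HM.
  apply Rlt_div_l in HM; [|lra].
  apply (Rmult_lt_compat_l x) in HM; [|exact hx].
  replace (x * (/ (2 * x) * t)) with (t / 2) in HM by (field; lra).
  unfold Rpower; rewrite <- exp_plus, <- (exp_ln eps) by exact he.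
  apply exp_increasing; lra.
Qed.

(* Integration by parts. *)
Lemma is_RInt_gen_Gamma_succ (x l : R) :
  0 < x ->
  is_RInt_gen (gamma_integrand x) (at_right 0) (Rbar_locally p_infty) l ->
  is_RInt_gen (gamma_integrand (x + 1)) (at_right 0) (Rbar_locally p_infty) (x * l).
Proof.
  intros hx hl.
  set (F := fun t => - (Rpower t x * exp (- t))).
  assert (hF : forall t, 0 < t ->
            is_derive F t (gamma_integrand (x + 1) t - x * gamma_integrand x t)).
  { intros t ht; unfold F, gamma_integrand, Rpower; auto_derive; [exact ht|].
    replace ((x + 1 - 1) * ln t) with (x * ln t) by ring.
    replace (exp ((x - 1) * ln t)) with (exp (x * ln t) * / t).
    - field; lra.
    - rewrite <- (exp_ln t ht) at 2.
      rewrite <- exp_Ropp, <- exp_plus; f_equal; ring. }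
  assert (hprod : forall P : R -> Prop, (forall t, 0 < t -> P t) ->
            filter_prod (at_right 0) (Rbar_locally p_infty)
              (fun ab => forall t, Rmin (fst ab) (snd ab) <= t
                                   <= Rmax (fst ab) (snd ab) -> P t)).
  { intros P hP.
    apply Filter_prod with (fun a => 0 < a) (fun b => 0 < b).
    - apply (at_right_0_eventually 1); [lra|]; intros t ht; lra.
    - exists 0; auto.
    - intros a b ha hb t ht; simpl in ht; apply hP.
      pose proof (Rmin_pos a b ha hb); lra. }
  assert (hD : is_RInt_gen (Derive F) (at_right 0) (Rbar_locally p_infty) (0 - 0)).
  { apply is_RInt_gen_Derive.
    - apply (hprod (fun t => ex_derive F t)); intros t ht; eexists; apply hF, ht.
    - apply (hprod (fun t => continuous (Derive F) t)); intros t ht.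
      apply continuous_ext_loc
        with (fun y => gamma_integrand (x + 1) y - x * gamma_integrand x y).
      + exists (mkposreal t ht); intros y hy.
        change (Rabs (y - t) < t) in hy; apply Rabs_def2 in hy.
        symmetry; apply is_derive_unique, hF; lra.
      + apply (continuous_minus (gamma_integrand (x + 1))
                 (fun y => x * gamma_integrand x y)).
        * apply gamma_integrand_continuous, ht.
        * apply (continuous_scal_r x (gamma_integrand x)),
            gamma_integrand_continuous, ht.
    - apply Rpower_exp_cv_0, hx.
    - apply Rpower_exp_cv_infty, hx. }
  pose proof (is_RInt_gen_plus _ _ _ _ hD (is_RInt_gen_scal _ x _ hl)) as h.
  replace (x * l) with (plus (0 - 0) (scal x l))
    by (change (0 - 0 + x * l = x * l); ring).
  revert h; apply is_RInt_gen_ext.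
  assert (h0 := hprod (fun t => plus (Derive F t) (scal x (gamma_integrand x t))
                                = gamma_integrand (x + 1) t)).
  eapply filter_imp; [|apply h0].
  - intros ab h t ht; apply h; lra.
  - intros t ht; rewrite (is_derive_unique _ _ _ (hF t ht)).
    change (gamma_integrand (x + 1) t - x * gamma_integrand x t
            + x * gamma_integrand x t = gamma_integrand (x + 1) t); ring.
Qed.

Lemma Gamma_eq (x l : R) :
  is_RInt_gen (gamma_integrand x) (at_right 0) (Rbar_locally p_infty) l ->
  Gamma x = l.
Proof. intros h; apply is_RInt_gen_unique, h. Qed.

Lemma Gamma_pos (x : R) : 0 < x <= 1 -> 0 < Gamma x.
Proof.
  intros hx; destruct (is_RInt_gen_Gamma_base x hx) as [l [h0 hl]].
  rewrite (Gamma_eq x l hl); exact h0.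
Qed.

Lemma Gamma_succ (x : R) : 0 < x <= 1 -> Gamma (x + 1) = x * Gamma x.
Proof.
  intros hx; destruct (is_RInt_gen_Gamma_base x hx) as [l [_ hl]].
  rewrite (Gamma_eq x l hl).
  apply Gamma_eq, is_RInt_gen_Gamma_succ; [apply hx|exact hl].
Qed.

(** The range of [Gamma_succ] does not include [2], so both integrations by parts are applied to the
    convergent integral itself. *)
Lemma Gamma_3 : Gamma 3 = 2 * Gamma 1.
Proof.
  destruct (is_RInt_gen_Gamma_base 1 ltac:(lra)) as [l [_ hl]].
  rewrite (Gamma_eq 1 l hl).
  apply is_RInt_gen_Gamma_succ in hl; [|lra].
  apply is_RInt_gen_Gamma_succ in hl; [|lra].
  replace (1 + 1 + 1) with 3 in hl by ring.
  rewrite (Gamma_eq 3 _ hl); ring.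
Qed.

(** * The hypergeometric solution *)

Lemma pochhammer_succ (a : R) (k : nat) :
  pochhammer a (S k) = pochhammer a k * (a + INR k).
Proof.
  change (pochhammer a (S k)) with (pochhammer a k * (a + INR (S k) - 1)).
  rewrite S_INR; ring.
Qed.

Lemma pochhammer_succ_l (a : R) (k : nat) :
  pochhammer a (S k) = a * pochhammer (a + 1) k.
Proof.
  induction k as [|k IH].
  - rewrite pochhammer_succ; change (1 * (a + 0) = a * 1); ring.
  - rewrite pochhammer_succ, IH, pochhammer_succ, S_INR; ring.
Qed.

Lemma pochhammer_pos (a : R) (k : nat) : 0 < a -> 0 < pochhammer a k.
Proof.
  intros ha; induction k as [|k IH]; [exact Rlt_0_1|].
  rewrite pochhammer_succ; pose proof (pos_INR k).
  apply Rmult_lt_0_compat; lra.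
Qed.

Definition gauss_coef (a b c : R) (k : nat) : R :=
  pochhammer a k * pochhammer b k / (pochhammer c k * INR (fact k)).

Lemma gauss_coef_pos (a b c : R) (k : nat) :
  0 < a -> 0 < b -> 0 < c -> 0 < gauss_coef a b c k.
Proof.
  intros ha hb hc; apply Rdiv_lt_0_compat; apply Rmult_lt_0_compat;
    auto using pochhammer_pos, INR_fact_lt_0.
Qed.

Lemma is_lim_seq_shift_ratio (a c : R) :
  0 < c -> is_lim_seq (fun n => (a + INR n) / (c + INR n)) 1.
Proof.
  intros hc.
  apply is_lim_seq_ext with (fun n => 1 + (a - c) * / (c + INR n)).
  - intros n; pose proof (pos_INR n); field; lra.
  - replace (Finite 1) with (Finite (1 + (a - c) * 0)) by (f_equal; ring).
    apply is_lim_seq_plus'; [apply is_lim_seq_const|].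
    apply (is_lim_seq_scal_l _ (a - c) 0).
    replace (Finite 0) with (Rbar_inv p_infty) by reflexivity.
    apply is_lim_seq_inv; [|discriminate].
    apply (is_lim_seq_plus _ _ c p_infty);
      [apply is_lim_seq_const|apply is_lim_seq_INR|reflexivity].
Qed.

Lemma gauss_ex_series (a b c x : R) :
  0 < a -> 0 < b -> 0 < c -> 0 < x < 1 ->
  ex_series (fun k => gauss_coef a b c k * x ^ k).
Proof.
  intros ha hb hc hx.
  assert (hpos : forall k, 0 < gauss_coef a b c k * x ^ k).
  { intros k; apply Rmult_lt_0_compat;
      [apply gauss_coef_pos; assumption|apply pow_lt, hx]. }
  apply ex_series_Rabs, ex_series_DAlembert with x; [lra| |].
  - intros k; specialize (hpos k); lra.
  - apply is_lim_seq_ext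
      with (fun n => (a + INR n) / (c + INR n) * ((b + INR n) / (1 + INR n)) * x).
    + intros n; rewrite Rabs_pos_eq
        by (apply Rlt_le, Rdiv_lt_0_compat; apply hpos).
      unfold gauss_coef; rewrite !pochhammer_succ, fact_simpl, mult_INR, S_INR.
      pose proof (pochhammer_pos a n ha); pose proof (pochhammer_pos b n hb).
      pose proof (pochhammer_pos c n hc); pose proof (INR_fact_lt_0 n).
      pose proof (pos_INR n); pose proof (pow_lt x n ltac:(lra)).
      simpl; field; repeat split; lra.
    + replace (Finite x) with (Finite (1 * 1 * x)) by (f_equal; ring).
      apply is_lim_seq_mult'; [|apply is_lim_seq_const].
      apply is_lim_seq_mult'; apply is_lim_seq_shift_ratio; lra.
Qed.

Lemma gauss_ex_pseries (a b c x : R) :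
  0 < a -> 0 < b -> 0 < c -> 0 < x < 1 -> ex_pseries (gauss_coef a b c) x.
Proof.
  intros ha hb hc hx; destruct (gauss_ex_series a b c x ha hb hc hx) as [l hl].
  exists l; apply is_pseries_R, hl.
Qed.

Lemma hyp2F1_le (a b c x y : R) :
  0 < a -> 0 < b -> 0 < c -> 0 < x -> x <= y -> y < 1 ->
  hyp2F1 a b c x <= hyp2F1 a b c y.
Proof.
  intros ha hb hc hx hxy hy.
  apply (Series_le (fun k => gauss_coef a b c k * x ^ k)
                   (fun k => gauss_coef a b c k * y ^ k)).
  - intros k; pose proof (gauss_coef_pos a b c k ha hb hc) as h; split.
    + apply Rmult_le_pos; [lra|apply pow_le; lra].
    + apply Rmult_le_compat_l; [lra|apply pow_incr; lra].
  - apply gauss_ex_series; auto; lra.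
Qed.

Lemma hyp2F1_pos (a b c x : R) :
  0 < a -> 0 < b -> 0 < c -> 0 < x < 1 -> 0 < hyp2F1 a b c x.
Proof.
  intros ha hb hc hx.
  pose proof (gauss_ex_series a b c x ha hb hc hx) as hex.
  change (0 < Series (fun k => gauss_coef a b c k * x ^ k)).
  rewrite Series_incr_1 by exact hex.
  assert (h : 0 <= Series (fun k => gauss_coef a b c (S k) * x ^ S k)).
  { rewrite <- (Rmult_0_l (Series (fun k => gauss_coef a b c (S k) * x ^ S k))).
    rewrite <- Series_scal_l.
    apply Series_le.
    - intros k; rewrite Rmult_0_l; split; [lra|].
      apply Rmult_le_pos; [apply Rlt_le, gauss_coef_pos; assumption|].
      apply pow_le; lra.
    - apply (ex_series_incr_1 (fun k => gauss_coef a b c k * x ^ k)), hex. }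
  assert (h0 : 0 < gauss_coef a b c 0 * x ^ 0).
  { rewrite Rmult_1_r; apply gauss_coef_pos; assumption. }
  lra.
Qed.

(** The parameters stay unsimplified so as to agree with those of [T] by conversion; a real index
    allows the neighbours [N - 1] and [N + 1]. *)
Definition gauss_half (b N x : R) : R :=
  hyp2F1 (1 / 2 + N) (b + N) (2 * (1 / 2) + 2 * N) x.

(** Coefficients of [x^0], [x^1] and [x^(j+2)] are compared, multiplication by [x] being the shift
    [PS_incr_1]. Once the Pochhammer symbols are reduced to common ones, each comparison is a
    rational identity. *)
Lemma gauss_half_contiguous (b N x : R) :
  0 < b -> 1 <= N -> 0 < x < 1 ->
  gauss_half b (N - 1) x
  = (1 - x / 2) * gauss_half b N x
    - (N + b) * (N + 1 - b) / (16 * N * (N + 1)) * x ^ 2 * gauss_half b (N + 1) x.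
Proof.
  intros hb hN hx.
  set (k := (N + b) * (N + 1 - b) / (16 * N * (N + 1))).
  set (u := fun M => gauss_coef (1 / 2 + M) (b + M) (2 * (1 / 2) + 2 * M)).
  assert (hu : forall M, 0 <= M -> ex_pseries (u M) x).
  { intros M hM; apply gauss_ex_pseries; lra. }
  change (PSeries (u (N - 1)) x
          = (1 - x / 2) * PSeries (u N) x - k * x ^ 2 * PSeries (u (N + 1)) x).
  rewrite (PSeries_ext _
    (PS_plus (u N) (PS_plus (PS_scal (- / 2) (PS_incr_1 (u N)))
       (PS_scal (- k) (PS_incr_1 (PS_incr_1 (u (N + 1)))))))).
  - pose proof (ex_pseries_incr_1 _ _ (hu N ltac:(lra))) as h1.
    pose proof (ex_pseries_incr_1 _ _ (ex_pseries_incr_1 _ _ (hu (N + 1) ltac:(lra)))) as h2.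
    assert (h3 : ex_pseries (PS_scal (- / 2) (PS_incr_1 (u N))) x)
      by (apply ex_pseries_scal; [apply Rmult_comm|exact h1]).
    assert (h4 : ex_pseries (PS_scal (- k) (PS_incr_1 (PS_incr_1 (u (N + 1))))) x)
      by (apply ex_pseries_scal; [apply Rmult_comm|exact h2]).
    rewrite !PSeries_plus, !PSeries_scal, !PSeries_incr_1;
      [field|exact h3|exact h4|apply hu; lra|apply ex_pseries_plus; assumption].
  - intros [|[|j]].
    + unfold PS_plus, PS_scal, PS_incr_1, u, gauss_coef; simpl.
      change (1 * 1 / (1 * 1) = 1 * 1 / (1 * 1) + (- / 2 * 0 + - k * 0)).
      field.
    + change (u (N - 1) 1%nat = u N 1%nat + (- / 2 * u N 0%nat + - k * 0)).
      assert (hp : forall a, pochhammer a 0 = 1) by reflexivity.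
      unfold u, gauss_coef; rewrite !pochhammer_succ, !hp; simpl; field; lra.
    + change (u (N - 1) (S (S j))
              = u N (S (S j)) + (- / 2 * u N (S j) + - k * u (N + 1) j)).
      unfold u, gauss_coef, k.
      pose proof (pos_INR j) as hj.
      rewrite (pochhammer_succ_l (1 / 2 + (N - 1)) (S j)),
        (pochhammer_succ_l (1 / 2 + (N - 1) + 1) j),
        (pochhammer_succ_l (b + (N - 1)) (S j)),
        (pochhammer_succ_l (b + (N - 1) + 1) j),
        (pochhammer_succ_l (1 / 2 + N) (S j)),
        (pochhammer_succ_l (1 / 2 + N) j),
        (pochhammer_succ_l (b + N) (S j)),
        (pochhammer_succ_l (b + N) j),
        (pochhammer_succ (1 / 2 + N + 1) j),
        (pochhammer_succ (b + N + 1) j).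
      replace (1 / 2 + (N - 1) + 1 + 1) with (1 / 2 + N + 1) by ring.
      replace (b + (N - 1) + 1 + 1) with (b + N + 1) by ring.
      replace (1 / 2 + (N + 1)) with (1 / 2 + N + 1) by ring.
      replace (b + (N + 1)) with (b + N + 1) by ring.
      (* A base raised by two is traded for two more factors; this brings the denominators at
         [N - 1], [N] and [N + 1] to the single symbol [X]. *)
      assert (hc2 : forall c, 0 < c ->
        pochhammer (c + 1 + 1) j = pochhammer c (S (S j)) / (c * (c + 1))).
      { intros c hc; rewrite !pochhammer_succ_l; field; lra. }
      set (c := 2 * (1 / 2) + 2 * (N - 1)).
      assert (hc : c = 2 * N - 1) by (unfold c; field).
      replace (2 * (1 / 2) + 2 * N) with (c + 1 + 1) by (unfold c; ring).
      replace (2 * (1 / 2) + 2 * (N + 1)) with (c + 1 + 1 + 1 + 1) by (unfold c; ring).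
      rewrite (pochhammer_succ_l c (S j)), (pochhammer_succ_l (c + 1) j).
      assert (e1 : pochhammer (c + 1 + 1) (S j)
                   = pochhammer (c + 1 + 1) j * (c + 1 + 1 + INR j))
        by apply pochhammer_succ.
      assert (e2 : pochhammer (c + 1 + 1) (S (S j))
                   = pochhammer (c + 1 + 1) j * (c + 1 + 1 + INR j)
                     * (c + 1 + 1 + INR j + 1))
        by (rewrite pochhammer_succ, e1, S_INR; ring).
      rewrite (hc2 (c + 1 + 1)), e1, e2 by lra.
      rewrite (fact_simpl (S j)), fact_simpl, !mult_INR, !S_INR.
      assert (hC : 0 < pochhammer (c + 1 + 1) j) by (apply pochhammer_pos; lra).
      pose proof (INR_fact_lt_0 j) as hf.
      set (X := pochhammer (c + 1 + 1) j) in *.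
      set (Y := pochhammer (1 / 2 + N + 1) j).
      set (Z := pochhammer (b + N + 1) j).
      rewrite hc.
      field; repeat split; lra.
Qed.

Lemma one_minus_inv_bounds (D : R) : 2 <= D -> 0 < 1 - 1 / D < 1.
Proof.
  intros hD; assert (0 < 1 / D <= 1 / 2); [|lra].
  split; [apply Rdiv_lt_0_compat; lra|].
  apply Rmult_le_compat_l; [lra|]; apply Rinv_le_contravar; lra.
Qed.

(** Up to a factor independent of [n] this is [s^n (1 - b)_n T_n(1/2, b; 1/x)]: the duplication
    formula turns [Gamma(1/2 + n) / Gamma(1 + 2n)] into [sqrt pi / (4^n n!)]. Without Gamma factors,
    positivity and monotonicity in [x] are visible. *)
Definition hyp_solution (b s x : R) (n : nat) : R :=
  (s * x / 4) ^ n * pochhammer (1 - b) n * pochhammer b n / INR (fact n)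
  * gauss_half b (INR n) x.

Lemma gauss_half_pos (b N x : R) :
  0 < b -> 0 <= N -> 0 < x < 1 -> 0 < gauss_half b N x.
Proof. intros hb hN hx; apply hyp2F1_pos; lra. Qed.

Lemma hyp_solution_pos (b s x : R) (n : nat) :
  0 < b < 1 -> 0 < s -> 0 < x < 1 -> 0 < hyp_solution b s x n.
Proof.
  intros hb hs hx; unfold hyp_solution.
  assert (hg : 0 < s * x / 4) by nra.
  pose proof (pow_lt _ n hg).
  pose proof (pochhammer_pos b n ltac:(lra)).
  pose proof (pochhammer_pos (1 - b) n ltac:(lra)).
  pose proof (gauss_half_pos b (INR n) x ltac:(lra) (pos_INR n) hx).
  pose proof (Rinv_0_lt_compat _ (INR_fact_lt_0 n)).
  repeat (assumption || apply Rmult_lt_0_compat).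
Qed.

Lemma hyp_solution_le (b s x y : R) (n : nat) :
  0 < b < 1 -> 0 < s -> 0 < x -> x <= y -> y < 1 ->
  hyp_solution b s x n <= hyp_solution b s y n.
Proof.
  intros hb hs hx hxy hy; unfold hyp_solution.
  assert (hg : 0 < s * x / 4) by nra.
  pose proof (pow_lt _ n hg).
  assert (hxy' : s * x / 4 <= s * y / 4) by nra.
  pose proof (pow_incr _ _ n (conj (Rlt_le _ _ hg) hxy')).
  pose proof (pochhammer_pos b n ltac:(lra)) as h1.
  pose proof (pochhammer_pos (1 - b) n ltac:(lra)) as h2.
  pose proof (Rinv_0_lt_compat _ (INR_fact_lt_0 n)) as h3.
  pose proof (gauss_half_pos b (INR n) x ltac:(lra) (pos_INR n) ltac:(lra)).
  pose proof (pos_INR n).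
  assert (gauss_half b (INR n) x <= gauss_half b (INR n) y)
    by (apply hyp2F1_le; lra).
  unfold Rdiv.
  apply Rmult_le_compat; [|lra| |assumption].
  - apply Rlt_le; repeat (assumption || apply Rmult_lt_0_compat).
  - repeat (apply Rmult_le_compat_r; [lra|]); assumption.
Qed.

(** For [b = 1 - 1/D] the Pochhammer symbols contribute [1 - b + n = (D n + 1) / D] and
    [b + n = (D (n + 1) - 1) / D], the factors of the partial numerators. The coefficient
    [1 - x / 2] of the contiguous relation at [N = n + 1] becomes [A = (4 s / x) (1 - x / 2)]. *)
Lemma hyp_solution_rec (D s x : R) :
  2 <= D -> 0 < s -> 0 < x < 1 ->
  cf_rec (s * (4 / x - 2)) (s ^ 2 / D ^ 2) D (hyp_solution (1 - 1 / D) s x).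
Proof.
  intros hD hs hx n.
  set (b := 1 - 1 / D).
  assert (hb : 0 < b < 1) by apply one_minus_inv_bounds, hD.
  assert (hDb : D = 1 / (1 - b)) by (unfold b; field; lra).
  pose proof (pos_INR n) as hn.
  pose proof (gauss_half_contiguous b (INR n + 1) x ltac:(lra) ltac:(lra) hx) as h.
  replace (INR n + 1 - 1) with (INR n) in h by ring.
  unfold hyp_solution.
  rewrite !pochhammer_succ, !fact_simpl, !mult_INR, !S_INR, h.
  pose proof (INR_fact_lt_0 n).
  rewrite hDb; simpl pow.
  field; repeat split; lra.
Qed.

Lemma Rroot_lt (A A' K D : R) :
  0 < A -> A < A' -> 0 < A ^ 2 - 4 * K * D ^ 2 -> Rroot A K D < Rroot A' K D.
Proof.
  intros hA hAA hd; unfold Rroot.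
  assert (sqrt (A ^ 2 - 4 * K * D ^ 2) <= sqrt (A' ^ 2 - 4 * K * D ^ 2))
    by (apply sqrt_le_1; nra).
  lra.
Qed.

(* For [x < y] the solution at [x] is bounded by the one at [y], whose growth
   rate is at most the strictly smaller dominant root at [y]: so the solution at
   [x] has no component along the dominant root. *)
Lemma hyp_solution_minimal (D s x : R) :
  2 <= D -> 0 < s -> 0 < x < 1 ->
  is_lim_seq (normalized (Rroot (s * (4 / x - 2)) (s ^ 2 / D ^ 2) D)
                (hyp_solution (1 - 1 / D) s x)) 0.
Proof.
  intros hD hs hx.
  set (K := s ^ 2 / D ^ 2); set (b := 1 - 1 / D).
  assert (hb : 0 < b < 1) by apply one_minus_inv_bounds, hD.
  assert (hA : forall t, 0 < t < 1 ->
            0 < s * (4 / t - 2) /\ 0 < (s * (4 / t - 2)) ^ 2 - 4 * K * D ^ 2).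
  { intros t ht.
    assert (h1 : 1 < / t) by (rewrite <- Rinv_1; apply Rinv_lt_contravar; lra).
    unfold Rdiv; split; [nra|].
    replace ((s * (4 * / t - 2)) ^ 2 - 4 * K * D ^ 2)
      with (s ^ 2 * (16 * / t * (/ t - 1))) by (unfold K; field; lra).
    apply Rmult_lt_0_compat; nra. }
  (* Any point strictly between [x] and [1] would do. [K] depends on [s] and [D] only, so moving to
     [y] changes just the coefficient [A], which decreases. *)
  set (y := (x + 1) / 2).
  assert (hy : 0 < y < 1) by (unfold y; lra).
  assert (hxy : x < y) by (unfold y; lra).
  destruct (hA x hx) as [hx1 hx2]; destruct (hA y hy) as [hy1 hy2].
  set (r := Rroot (s * (4 / x - 2)) K D); set (r' := Rroot (s * (4 / y - 2)) K D).
  destruct (Rroot_spec _ K D hx1 hD hx2) as [hr _].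
  destruct (Rroot_spec _ K D hy1 hD hy2) as [hr' [hroot' he']].
  fold r in hr; fold r' in hr', hroot', he'.
  assert (hrr : r' < r).
  { apply Rroot_lt; try assumption.
    assert (/ y < / x) by (apply Rinv_lt_contravar; nra).
    unfold Rdiv; nra. }
  destruct (perturbed_rec_cv _ _ _ he'
              (normalized_rec _ K D r' _ ltac:(lra) hroot'
                 (hyp_solution_rec D s y hD hs hy))) as [l [hl _]].
  fold b in hl.
  apply is_lim_seq_le_le with (fun _ => 0)
    (fun n => normalized r' (hyp_solution b s y) n * (r' / r) ^ S n).
  - intros n; unfold normalized.
    pose proof (INR_fact_lt_0 n) as hf.
    pose proof (pow_lt r (S n) hr) as hrn; pose proof (pow_lt r' (S n) hr') as hrn'.
    assert (hfr : 0 < INR (fact n) * r ^ S n) by (apply Rmult_lt_0_compat; assumption).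
    split.
    + apply Rlt_le, Rdiv_lt_0_compat; [apply hyp_solution_pos; assumption|exact hfr].
    + unfold Rdiv at 3; rewrite Rpow_mult_distr, pow_inv.
      replace (hyp_solution b s y (S n) / (INR (fact n) * r' ^ S n)
               * (r' ^ S n * / r ^ S n))
        with (hyp_solution b s y (S n) / (INR (fact n) * r ^ S n)).
      * apply Rmult_le_compat_r; [apply Rlt_le, Rinv_0_lt_compat, hfr|].
        apply hyp_solution_le; lra.
      * set (rn := r ^ S n) in *; set (rn' := r' ^ S n) in *; field; lra.
  - apply is_lim_seq_const.
  - replace (Finite 0) with (Finite (l * 0)) by (f_equal; ring).
    apply is_lim_seq_mult'; [exact hl|].
    apply (is_lim_seq_incr_1 (fun n => (r' / r) ^ n)), is_lim_seq_geom.
    rewrite Rabs_pos_eq by (apply Rlt_le, Rdiv_lt_0_compat; assumption).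
    apply Rlt_div_l; lra.
Qed.

(** * The limit as a quotient of values of a minimal solution *)

Lemma cf_rec_unique (A K D : R) (y z : nat -> R) :
  cf_rec A K D y -> cf_rec A K D z -> y 0%nat = z 0%nat -> y 1%nat = z 1%nat ->
  forall n, y n = z n.
Proof.
  intros hy hz h0 h1 n.
  enough (y n = z n /\ y (S n) = z (S n)) by tauto.
  induction n as [|n [IH1 IH2]]; [auto|].
  split; [exact IH2|]; rewrite hy, hz, IH1, IH2; reflexivity.
Qed.

(* Pincherle: the limit of the convergents is read off a minimal solution. *)
Lemma minimal_solution_limit (A K D a1 b0 r V L : R) (y : nat -> R) :
  b0 <> 0 -> r <> 0 -> V <> 0 ->
  cf_rec A K D y -> y 0%nat <> 0 ->
  is_lim_seq (normalized r y) 0 ->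
  is_lim_seq (normalized r (Cq A K D a1 b0)) V ->
  is_lim_seq (fun n => Cp A K D a1 b0 n / Cq A K D a1 b0 n) L ->
  a1 - y 1%nat / y 0%nat <> 0 /\ L = b0 / (a1 - y 1%nat / y 0%nat).
Proof.
  intros hb hr hV hy hy0 hlim hq hL.
  set (p := Cp A K D a1 b0) in *; set (q := Cq A K D a1 b0) in *.
  (* Forced by index [1], where [p(1) = b0] and [q(1) = a1]. *)
  set (al := (y 1%nat - a1 * y 0%nat) / b0).
  assert (hyn : forall n, y n = al * p n + y 0%nat * q n).
  { apply cf_rec_unique with A K D; [exact hy| | |].
    - intros n; unfold p, q; rewrite Cp_rec, Cq_rec; ring.
    - change (y 0%nat = al * 0 + y 0%nat * 1); ring.
    - change (y 1%nat = al * (0 * a1 + b0) + y 0%nat * a1).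
      unfold al; field; exact hb. }
  (* Divide [y = al p + y(0) q] by [q]: the left side tends to [0] because [V] is nonzero, so
     [al L = - y(0)]. *)
  assert (h1 : is_lim_seq (fun n => normalized r y n / normalized r q n) (0 / V))
    by (apply is_lim_seq_div'; assumption).
  assert (h2 : is_lim_seq (fun n => al * (p (S n) / q (S n)) + y 0%nat)
                 (al * L + y 0%nat)).
  { apply is_lim_seq_plus'; [|apply is_lim_seq_const].
    apply (is_lim_seq_scal_l _ al L).
    apply (is_lim_seq_incr_1 (fun n => p n / q n)), hL. }
  assert (h3 : is_lim_seq (fun n => normalized r y n / normalized r q n)
                 (al * L + y 0%nat)).
  { apply is_lim_seq_ext_loc with (2 := h2).
    destruct (is_lim_seq_neq0_eventually _ _ hq hV) as [N HN].
    exists N; intros n hn; specialize (HN n hn).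
    assert (q (S n) <> 0).
    { intros h; apply HN; unfold normalized; rewrite h; unfold Rdiv; ring. }
    rewrite normalized_ratio, (hyn (S n)) by exact hr; field; assumption. }
  apply is_lim_seq_unique in h1; apply is_lim_seq_unique in h3.
  rewrite h1 in h3; injection h3; intros h4.
  assert (h5 : L * (a1 - y 1%nat / y 0%nat) = b0).
  { assert (h6 : L * al = - y 0%nat) by (unfold Rdiv in h4; lra).
    replace (L * (a1 - y 1%nat / y 0%nat)) with (- (L * al) * b0 / y 0%nat)
      by (unfold al; field; auto).
    rewrite h6; field; exact hy0. }
  assert (h7 : a1 - y 1%nat / y 0%nat <> 0).
  { intros h; rewrite h, Rmult_0_r in h5; auto. }
  split; [exact h7|].
  rewrite <- h5; set (d := a1 - _) in *; field; exact h7.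
Qed.

(** In the ratio [Gamma(1/2)], [Gamma(b)], [Gamma(1)] and [x^(1/2)] cancel. The factor
    [s / D = s (1 - b)], later [sqrt K], is the quotient of the weights [s^n (1 - b)_n] at [n = 1]
    and [n = 0]. *)
Lemma T_ratio (D s x : R) :
  2 <= D -> 0 < s -> 0 < x < 1 ->
  s / D * (T 1 (1 / 2) (1 - 1 / D) (/ x) / T 0 (1 / 2) (1 - 1 / D) (/ x))
  = hyp_solution (1 - 1 / D) s x 1 / hyp_solution (1 - 1 / D) s x 0.
Proof.
  intros hD hs hx.
  set (b := 1 - 1 / D).
  assert (hb : 0 < b < 1) by apply one_minus_inv_bounds, hD.
  assert (hDb : D = 1 / (1 - b)) by (unfold b; field; lra).
  unfold T, hyp_solution.
  rewrite !pochhammer_succ.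
  change (pochhammer (1 - b) 0) with 1; change (pochhammer b 0) with 1.
  change (hyp2F1 (1 / 2 + INR 1) (b + INR 1) (2 * (1 / 2) + 2 * INR 1) (1 / / x))
    with (gauss_half b (INR 1) (1 / / x)).
  change (hyp2F1 (1 / 2 + INR 0) (b + INR 0) (2 * (1 / 2) + 2 * INR 0) (1 / / x))
    with (gauss_half b (INR 0) (1 / / x)).
  replace (1 / / x) with x by (field; lra).
  pose proof (gauss_half_pos b (INR 0) x ltac:(lra) (pos_INR 0) hx) as h0.
  set (F0 := gauss_half b (INR 0) x) in *; set (F1 := gauss_half b (INR 1) x).
  simpl INR.
  rewrite Rpower_plus, Rpower_1 by lra.
  replace (2 * (1 / 2) + 2 * 1) with 3 by field.
  replace (2 * (1 / 2) + 2 * 0) with 1 by field.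
  rewrite !Rplus_0_r, !Gamma_succ, Gamma_3 by lra.
  pose proof (Gamma_pos (1 / 2) ltac:(lra)); pose proof (Gamma_pos b ltac:(lra)).
  pose proof (Gamma_pos 1 ltac:(lra)).
  assert (0 < Rpower x (1 / 2)) by apply exp_pos.
  rewrite hDb; simpl; field; repeat split; lra.
Qed.

Theorem theorem4p1 (A K D a1 b0 : R)
  (hA : 0 < A) (hK : K <> 0) (hD : 2 <= D)
  (hdisc : 0 < A ^ 2 - 4 * K * D ^ 2)
  (* the degenerate cases in which p(n)/q(n) is constantly 0 or the limit is
     the point at infinity *)
  (hb0 : b0 <> 0)
  (hinf : ~ is_lim_seq (fun n => Rabs (Cp A K D a1 b0 n / Cq A K D a1 b0 n))
              p_infty) :
  let p := Cp A K D a1 b0 in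
  let q := Cq A K D a1 b0 in
  let p' := fun n => p n / fnorm K D n in
  let q' := fun n => q n / fnorm K D n in
  let E := Erate A K D in
  exists L : R,
    converges_exponentially (fun n => p n / q n) L /\
    (exists C1 C2 : R,
      C1 <> 0 /\ C2 <> 0 /\
      equiv_seq (fun n => L - p n / q n) (fun n => C1 / E ^ n) /\
      equiv_seq q (fun n => C2 * INR (fact (n - 1)) * Rroot A K D ^ n) /\
      equiv_seq (fun n => ln (Rabs (q' n * L - p' n)))
                (fun n => - INR n * ln (Rabs E) / 2)) /\
    (0 < K ->
      a1 - sqrt (Rabs K) * Q A K D <> 0 /\
      L = b0 / (a1 - sqrt (Rabs K) * Q A K D)).
Proof.
  intros p q p' q' E.
  destruct (convergents_asymptotics A K D a1 b0 hA hK hD hdisc hb0 hinf)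
    as (L & C1 & C2 & hconv & hC1 & hC2 & hq & h1 & h2 & h3).
  exists L; split; [exact hconv|split; [exists C1, C2; auto|]].
  intros hK0; rewrite (Rabs_pos_eq K) by lra.
  pose proof (sqrt_lt_R0 K hK0) as hk.
  pose proof (pow2_sqrt K (Rlt_le _ _ hK0)) as hk2.
  unfold Q, z0; rewrite (Rabs_pos_eq K) by lra.
  set (k := sqrt K) in *.
  set (s := D * k); set (z := 1 / 2 + A / (4 * D * k)).
  assert (hs : 0 < s) by (apply Rmult_lt_0_compat; lra).
  (* The discriminant condition reads [A^2 > 4 s^2]; it puts [z] beyond [1], hence [1 / z] inside
     the disc of convergence of the Gauss series. *)
  assert (hAs : 2 * s < A) by (unfold s; nra).
  assert (hz : 1 < z).
  { unfold z; replace (A / (4 * D * k)) with (A / s / 4) by (unfold s; field; lra).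
    assert (2 < A / s) by (apply Rlt_div_r; lra); lra. }
  set (x := / z).
  assert (hx : 0 < x < 1).
  { split; [apply Rinv_0_lt_compat; lra|].
    rewrite <- Rinv_1; apply Rinv_lt_contravar; lra. }
  assert (hzx : z = / x) by (unfold x; rewrite Rinv_inv; reflexivity).
  assert (hAx : A = s * (4 / x - 2)).
  { unfold x, Rdiv; rewrite Rinv_inv; unfold z, s; field; lra. }
  assert (hKs : K = s ^ 2 / D ^ 2) by (rewrite <- hk2; unfold s; field; lra).
  replace k with (s / D) by (unfold s; field; lra).
  rewrite hzx, T_ratio by assumption.
  destruct (Rroot_spec A K D hA hD hdisc) as [hr _].
  apply minimal_solution_limit with A K D (Rroot A K D) C2; auto.
  - lra.
  - rewrite hAx, hKs; apply hyp_solution_rec; assumption.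
  - apply Rgt_not_eq, hyp_solution_pos; auto.
    apply one_minus_inv_bounds, hD.
  - rewrite hAx, hKs; apply hyp_solution_minimal; assumption.
  - apply hconv.
Qed.
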